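(* Let $q(z)=\sum_{j\ge 1} q_j z^j$ with all $q_j\ge 0$ be analytic in the open unit disc $\{|z|<1\}$ with $0<q(1)<+\infty$, where $q(1)=\sum_{j\ge1}q_j$. Then the solution $\Phi$, analytic in the open unit disc, of the problem $$\int_{0}^{+\infty}\Phi\left(z\,e^{r(q(z)-q(1))}\right)dr=\frac{\Phi(z)}{q(1)}\quad(|z|<1),\qquad \Phi(0)=0,\qquad \Phi'(0)=1,$$ exists, is unique, and is given by $$\Phi(z)=z\exp\left(\int_0^z\frac{q'(\zeta)\zeta+q(\zeta)}{(q(1)-q(\zeta))\,\zeta}\,d\zeta\right),\qquad |z|<1.$$
   Context: The inner integral $\int_0^z$ is a complex line integral along any path in the open unit disc from $0$ to $z$; the integrand has a removable singularity at $\zeta=0$ because $q(0)=0$. *)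

(* Defs.v *)
From Stdlib Require Export Reals.
From Coquelicot Require Export Coquelicot.

Open Scope R_scope.

Definition Cexp (z : C) : C := (exp (Re z) * cos (Im z), exp (Re z) * sin (Im z)).

Definition in_disc (z : C) : Prop := Cmod z < 1.

Definition analytic_at (f : C -> C) (z0 : C) : Prop :=
  exists a : nat -> C,
    locally (T := C_UniformSpace) z0
      (fun z => is_pseries (K := C_AbsRing) (V := C_NormedModule)
                  a (z - z0)%C (f z)).

Definition analytic_in_disc (f : C -> C) : Prop :=
  forall z : C, in_disc z -> analytic_at f z.

(* [f] with its (removable) singularity at [a] filled in by the limit.
   [C_lim] is a limit along the horizontal line through [a], and agrees with the
   complex limit as soon as the latter exists ([is_C_lim_unique]). *)
Definition fill_singularity (a : C) (f : C -> C) (z : C) : C :=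
  if Ceq_dec z a then C_lim f a else f z.

Definition velocity (g : R -> C) (t : R) : C :=
  (Derive (fun s => Re (g s)) t, Derive (fun s => Im (g s)) t).

Definition C1_curve (g : R -> C) : Prop :=
  forall t : R,
    ex_derive (K := R_AbsRing) (V := C_R_NormedModule) g t /\
    continuous (T := R_UniformSpace) (U := C_UniformSpace) (velocity g) t.

(* On each closed piece [g] agrees with a curve that is C^1 on all of R, which
   is the same as being C^1 on that piece with one-sided derivatives at its
   two end points. *)
Definition piecewise_C1 (g : R -> C) : Prop :=
  exists (n : nat) (t : nat -> R),
    t O = 0 /\ t n = 1 /\
    forall i : nat, (i < n)%nat ->
      t i < t (S i) /\
      exists h : R -> C, C1_curve h /\
        forall s : R, t i <= s <= t (S i) -> g s = h s.

Definition path_in_disc (g : R -> C) (a b : C) : Prop :=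
  piecewise_C1 g /\ g 0 = a /\ g 1 = b /\
  forall t : R, 0 <= t <= 1 -> in_disc (g t).

(* At the finitely many corners of [g] the value of [velocity g] is a junk
   value, which does not affect the Riemann integral. *)
Definition is_line_integral (f : C -> C) (g : R -> C) (l : C) : Prop :=
  is_RInt (V := C_R_NormedModule)
    (fun t : R => (f (g t) * velocity g t)%C) 0 1 l.

Definition is_solution (q : C -> C) (q1 : R) (Phi : C -> C) : Prop :=
  analytic_in_disc Phi /\
  (forall z : C, in_disc z ->
     is_RInt_gen (V := C_R_NormedModule)
       (fun r : R => Phi (z * Cexp (RtoC r * (q z - RtoC q1)))%C)
       (at_point 0) (Rbar_locally p_infty) (Phi z / RtoC q1)%C) /\
  Phi (RtoC 0) = RtoC 0 /\
  is_derive (K := C_AbsRing) (V := C_NormedModule) Phi (RtoC 0) (RtoC 1).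

Definition integrand (q : C -> C) (q1 : R) : C -> C :=
  fill_singularity (RtoC 0)
    (fun zeta => ((C_derive q zeta * zeta + q zeta)
                  / ((RtoC q1 - q zeta) * zeta))%C).

(* Main.v *)
(* Along the curve r |-> z e^{r (q(z) - q(1))} the integral of a function Psi
   with Psi(0) = 0 equals M(z) / (q(1) - q(z)), where M is the primitive of
   Psi(z) / z vanishing at 0.  The integral equation is therefore equivalent to
   (q(1) - q(z)) Psi(z) = q(1) M(z), i.e. to a recursion on the Taylor
   coefficients a_n of Psi that determines them from a_0 = 0 and a_1 = 1.  As
   the q_j are nonnegative with sum q(1), induction gives 0 <= a_n <= n, so the
   solution Phi converges in the unit disc; uniqueness near 0 spreads to the disc
   by the identity theorem.  In the same way the integrand has a Taylor series
   with coefficients 0 <= h_n <= n + 2.  Its primitive L satisfies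
   (Phi(z) / z)' = L'(z) Phi(z) / z, so (Phi(z) / z) e^{-L(z)} is constant. *)
Require Import Defs.
From Stdlib Require Import Reals Lra Lia.
From Coquelicot Require Import Coquelicot.

(** * Derivatives and integrals of curves in the complex plane *)

(** Analyticity is given as local power series, so identities between functions are proved in two
    ways only: by comparing coefficients, which calls for Cauchy products and recentring, or by
    differentiating along a real curve, namely a path, the ray [t * z], or the spiral of the
    integral equation. Nonnegativity of the [qc j] acts twice. It keeps the recursions positive,
    which gives the coefficient bounds, and it gives [Cmod (q z) < q1], hence [Re (q z - q1) < 0]:
    the spiral then shrinks to 0 without ever exceeding modulus [Cmod z], so the integral converges
    and sees only values of the function on that disc. A competing solution has an expansion at 0 of
    unknown radius. This is why power series carry a radius throughout and why the recursion is
    extracted on a small disc before agreement is propagated. The bound n on the coefficients is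
    attained: for q(z) = z the solution is z / (1 - z)^2. *)

Notation is_Cseries := (is_series (K := C_AbsRing) (V := C_NormedModule)).
Notation is_Cderive := (is_derive (K := C_AbsRing) (V := C_NormedModule)).
Notation is_Rderive := (is_derive (K := R_AbsRing) (V := C_R_NormedModule)).

(** A limit point of [locally x] is [x] itself, so the quantifier over limit points inside
    [is_derive] collapses to one estimate. *)
Lemma is_derive_eps (K : AbsRing) (V : NormedModule K) (f : K -> V) (x : K) (l : V) :
  is_derive f x l <->
  forall eps : posreal, exists delta : posreal, forall y : K,
    abs (minus y x) < delta ->
    norm (minus (minus (f y) (f x)) (scal (minus y x) l)) <= eps * abs (minus y x).
Proof.
  split.
  - intros [_ H] eps.
    destruct (H x (fun P HP => HP) eps) as [d Hd].
    exists d. intros y Hy. apply Hd. exact Hy.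
  - intros H. split.
    + apply is_linear_scal_l.
    + intros x' Hx' eps.
      apply (is_filter_lim_locally_unique (V := AbsRing_NormedModule K)) in Hx'. subst x'.
      destruct (H eps) as [d Hd]. exists d. intros y Hy. apply Hd. exact Hy.
Qed.

Lemma is_Cderive_eps (f : C -> C) (x l : C) :
  is_Cderive f x l <->
  forall eps : posreal, exists delta : posreal, forall y : C,
    Cmod (y - x) < delta ->
    Cmod (f y - f x - (y - x) * l) <= eps * Cmod (y - x).
Proof. exact (is_derive_eps C_AbsRing C_NormedModule f x l). Qed.

Lemma is_Rderive_eps (f : R -> C) (x : R) (l : C) :
  is_Rderive f x l <->
  forall eps : posreal, exists delta : posreal, forall y : R,
    Rabs (y - x) < delta ->
    Cmod (f y - f x - RtoC (y - x) * l) <= eps * Rabs (y - x).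
Proof.
  rewrite (is_derive_eps R_AbsRing C_R_NormedModule f x l).
  (* The norm of C as a real module is a product norm; [Cmod_norm] identifies it with the
     modulus. *)
  assert (E : forall y, 
    norm (K := R_AbsRing) (V := C_R_NormedModule)
      (minus (G := C_R_NormedModule) (minus (G := C_R_NormedModule) (f y) (f x))
        (scal (K := R_AbsRing) (V := C_R_NormedModule) (minus (G := R_AbsRing) y x) l))
    = Cmod (f y - f x - RtoC (y - x) * l)%C).
  { intros y. etransitivity; [symmetry; apply Cmod_norm|]. f_equal.
    apply injective_projections; simpl; unfold minus, plus, opp, scal; simpl; unfold mult; simpl; ring. }
  split; intros H eps; destruct (H eps) as [d Hd]; exists d; intros y Hy.
  - rewrite <- E. apply Hd. exact Hy.
  - rewrite E. apply Hd. exact Hy.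
Qed.

Lemma Cmod_le_sum (z : C) : Cmod z <= Rabs (fst z) + Rabs (snd z).
Proof.
  replace z with ((RtoC (fst z)) + (0, snd z))%C
    by (apply injective_projections; simpl; ring).
  eapply Rle_trans; [apply Cmod_triangle|].
  apply Rplus_le_compat.
  - rewrite Cmod_R. simpl. rewrite Rplus_0_r. lra.
  - unfold Cmod. simpl. right.
    rewrite <- sqrt_Rsqr_abs. f_equal. unfold Rsqr. ring.
Qed.

Lemma Rabs_fst_le (z : C) : Rabs (fst z) <= Cmod z.
Proof. eapply Rle_trans; [apply Rmax_l | apply Rmax_Cmod]. Qed.

Lemma Rabs_snd_le (z : C) : Rabs (snd z) <= Cmod z.
Proof. eapply Rle_trans; [apply Rmax_r | apply Rmax_Cmod]. Qed.

Lemma is_derive_eps_R (f : R -> R) (x l : R) :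
  is_derive f x l <->
  forall eps : posreal, exists delta : posreal, forall y : R,
    Rabs (y - x) < delta -> Rabs (f y - f x - (y - x) * l) <= eps * Rabs (y - x).
Proof. exact (is_derive_eps R_AbsRing R_NormedModule f x l). Qed.

(** Passing to components makes real calculus ([auto_derive], the fundamental theorem, the mean
    value theorem) available for curves. *)
Lemma is_Rderive_pair (f : R -> C) (x : R) (l : C) :
  is_Rderive f x l <->
  is_derive (fun t => fst (f t)) x (fst l) /\ is_derive (fun t => snd (f t)) x (snd l).
Proof.
  rewrite is_Rderive_eps, !is_derive_eps_R.
  split.
  - intros H; split; intros eps; destruct (H eps) as [d Hd]; exists d; intros y Hy;
      eapply Rle_trans; [|apply (Hd y Hy)| |apply (Hd y Hy)].
    + eapply Rle_trans; [|apply Rabs_fst_le]. right. f_equal. simpl. ring.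
    + eapply Rle_trans; [|apply Rabs_snd_le]. right. f_equal. simpl. ring.
  - intros [H1 H2] eps.
    destruct (H1 (pos_div_2 eps)) as [d1 Hd1].
    destruct (H2 (pos_div_2 eps)) as [d2 Hd2].
    assert (Hd : 0 < Rmin d1 d2) by (apply Rmin_pos; apply cond_pos).
    exists (mkposreal _ Hd). intros y Hy. simpl in Hy.
    specialize (Hd1 y (Rlt_le_trans _ _ _ Hy (Rmin_l _ _))).
    specialize (Hd2 y (Rlt_le_trans _ _ _ Hy (Rmin_r _ _))).
    simpl in Hd1, Hd2.
    eapply Rle_trans; [apply Cmod_le_sum|].
    replace (fst (f y - f x - RtoC (y - x) * l)%C) with (fst (f y) - fst (f x) - (y - x) * fst l) by (simpl; ring).
    replace (snd (f y - f x - RtoC (y - x) * l)%C) with (snd (f y) - snd (f x) - (y - x) * snd l) by (simpl; ring).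
    lra.
Qed.

Lemma is_Rderive_mult (f g : R -> C) (x : R) (df dg : C) :
  is_Rderive f x df -> is_Rderive g x dg ->
  is_Rderive (fun t => f t * g t)%C x (df * g x + f x * dg)%C.
Proof.
  rewrite !is_Rderive_pair. intros [F1 F2] [G1 G2].
  (* Opaque component functions let [auto_derive] treat them as unknowns with a known derivative. *)
  pose (f1 t := fst (f t)). change (is_derive f1 x (fst df)) in F1. pose (f2 t := snd (f t)). change (is_derive f2 x (snd df)) in F2.
  pose (g1 t := fst (g t)). change (is_derive g1 x (fst dg)) in G1. pose (g2 t := snd (g t)). change (is_derive g2 x (snd dg)) in G2.
  split.
  - change (is_derive (fun t => f1 t * g1 t - f2 t * g2 t) x
      (fst df * g1 x - snd df * g2 x + (f1 x * fst dg - f2 x * snd dg))).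
    clearbody f1 f2 g1 g2. auto_derive.
    + repeat split; trivial; eexists; eassumption.
    + rewrite (is_derive_unique (fun t : R => f1 t) _ _ F1), (is_derive_unique (fun t : R => f2 t) _ _ F2),
        (is_derive_unique (fun t : R => g1 t) _ _ G1), (is_derive_unique (fun t : R => g2 t) _ _ G2). ring.
  - change (is_derive (fun t => f1 t * g2 t + f2 t * g1 t) x
      (fst df * g2 x + snd df * g1 x + (f1 x * snd dg + f2 x * fst dg))).
    clearbody f1 f2 g1 g2. auto_derive.
    + repeat split; trivial; eexists; eassumption.
    + rewrite (is_derive_unique (fun t : R => f1 t) _ _ F1), (is_derive_unique (fun t : R => f2 t) _ _ F2),
        (is_derive_unique (fun t : R => g1 t) _ _ G1), (is_derive_unique (fun t : R => g2 t) _ _ G2). ring.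
Qed.

Lemma is_Rderive_Cexp (g : R -> C) (x : R) (dg : C) :
  is_Rderive g x dg -> is_Rderive (fun t => Cexp (g t)) x (Cexp (g x) * dg)%C.
Proof.
  rewrite !is_Rderive_pair. intros [G1 G2].
  pose (g1 t := fst (g t)). change (is_derive g1 x (fst dg)) in G1. pose (g2 t := snd (g t)). change (is_derive g2 x (snd dg)) in G2.
  split.
  - change (is_derive (fun t => exp (g1 t) * cos (g2 t)) x
      (exp (g1 x) * cos (g2 x) * fst dg - exp (g1 x) * sin (g2 x) * snd dg)).
    clearbody g1 g2. auto_derive.
    + repeat split; trivial; eexists; eassumption.
    + rewrite (is_derive_unique (fun t : R => g1 t) _ _ G1), (is_derive_unique (fun t : R => g2 t) _ _ G2). ring.
  - change (is_derive (fun t => exp (g1 t) * sin (g2 t)) x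
      (exp (g1 x) * cos (g2 x) * snd dg + exp (g1 x) * sin (g2 x) * fst dg)).
    clearbody g1 g2. auto_derive.
    + repeat split; trivial; eexists; eassumption.
    + rewrite (is_derive_unique (fun t : R => g1 t) _ _ G1), (is_derive_unique (fun t : R => g2 t) _ _ G2). ring.
Qed.

Lemma is_Rderive_linear (z : C) (x : R) : is_Rderive (fun t => RtoC t * z)%C x z.
Proof.
  apply is_Rderive_pair. simpl. split; auto_derive; trivial; ring.
Qed.

(** A chain rule across two scalar fields: [F] is complex differentiable, [g] only real
    differentiable. The error splits into the remainder of [F] at [g x] plus [l] times the remainder
    of [g], each at most half of [eps]. *)
Lemma is_Rderive_comp (F : C -> C) (g : R -> C) (x : R) (l v : C) :
  is_Cderive F (g x) l -> is_Rderive g x v ->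
  is_Rderive (fun t => F (g t)) x (v * l)%C.
Proof.
  rewrite is_Cderive_eps, !is_Rderive_eps. intros HF Hg eps.
  assert (Hv := Cmod_ge_0 v). assert (Hl := Cmod_ge_0 l).
  assert (He := cond_pos eps).
  set (e1 := eps / (2 * (Cmod v + 1))).
  assert (He1 : 0 < e1) by (apply Rdiv_lt_0_compat; lra).
  destruct (HF (mkposreal _ He1)) as [d1 Hd1]. simpl in Hd1.
  (* The bound 1 gives the Lipschitz estimate with constant [Cmod v + 1]; the other bound controls
     the remainder of [g] after multiplication by [l]. *)
  set (e2 := Rmin 1 (eps / (2 * (Cmod l + 1)))).
  assert (He2 : 0 < e2) by (apply Rmin_pos; [lra | apply Rdiv_lt_0_compat; lra]).
  destruct (Hg (mkposreal _ He2)) as [d2 Hd2]. simpl in Hd2.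
  assert (Hd : 0 < Rmin d2 (d1 / (Cmod v + 1))).
  { apply Rmin_pos; [apply cond_pos|]. apply Rdiv_lt_0_compat; [apply cond_pos|lra]. }
  exists (mkposreal _ Hd). intros y Hy. simpl in Hy.
  specialize (Hd2 y (Rlt_le_trans _ _ _ Hy (Rmin_l _ _))).
  assert (Hy1 := Rlt_le_trans _ _ _ Hy (Rmin_r _ _)).
  assert (Ha := Rabs_pos (y - x)).
  assert (Hgy : Cmod (g y - g x) <= (Cmod v + 1) * Rabs (y - x)).
  { replace (g y - g x)%C with ((g y - g x - RtoC (y - x) * v) + RtoC (y - x) * v)%C by ring.
    eapply Rle_trans; [apply Cmod_triangle|].
    rewrite Cmod_mult, Cmod_R.
    assert (e2 <= 1) by apply Rmin_l. nra. }
  assert (Hlt : Cmod (g y - g x) < d1).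
  { eapply Rle_lt_trans; [exact Hgy|].
    apply (Rmult_lt_compat_l (Cmod v + 1)) in Hy1; [|lra].
    replace ((Cmod v + 1) * (d1 / (Cmod v + 1))) with (pos d1) in Hy1 by (field; lra). exact Hy1. }
  specialize (Hd1 _ Hlt).
  replace (F (g y) - F (g x) - RtoC (y - x) * (v * l))%C
    with ((F (g y) - F (g x) - (g y - g x) * l) + (g y - g x - RtoC (y - x) * v) * l)%C by ring.
  eapply Rle_trans; [apply Cmod_triangle|]. rewrite Cmod_mult.
  assert (A1 : e1 * Cmod (g y - g x) <= eps / 2 * Rabs (y - x)).
  { apply Rle_trans with (e1 * ((Cmod v + 1) * Rabs (y - x))).
    - apply Rmult_le_compat_l; lra.
    - right. unfold e1. field. lra. }
  assert (A2 : Cmod (g y - g x - RtoC (y - x) * v) * Cmod l <= eps / 2 * Rabs (y - x)).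
  { apply Rle_trans with (e2 * Rabs (y - x) * (Cmod l + 1)).
    - apply Rmult_le_compat; try lra. apply Cmod_ge_0.
    - apply Rle_trans with (eps / (2 * (Cmod l + 1)) * Rabs (y - x) * (Cmod l + 1)).
      + apply Rmult_le_compat_r; [lra|]. apply Rmult_le_compat_r; [lra|]. apply Rmin_r.
      + right. field. lra. }
  lra.
Qed.

Lemma is_RInt_Rderive (G dG : R -> C) (a b : R) :
  (forall t, Rmin a b <= t <= Rmax a b -> is_Rderive G t (dG t)) ->
  (forall t, Rmin a b <= t <= Rmax a b ->
     continuous (T := R_UniformSpace) (U := C_UniformSpace) dG t) ->
  is_RInt (V := C_R_NormedModule) dG a b (G b - G a)%C.
Proof.
  intros H1 H2.
  apply (is_RInt_fct_extend_pair (U := R_NormedModule) (V := R_NormedModule)).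
  - apply (is_RInt_derive (fun t => fst (G t)) (fun t => fst (dG t))).
    + intros t Ht. apply is_Rderive_pair, H1, Ht.
    + intros t Ht. apply (continuous_comp dG fst); [apply H2, Ht | apply continuous_fst].
  - apply (is_RInt_derive (fun t => snd (G t)) (fun t => snd (dG t))).
    + intros t Ht. apply is_Rderive_pair, H1, Ht.
    + intros t Ht. apply (continuous_comp dG snd); [apply H2, Ht | apply continuous_snd].
Qed.

(** * Complex series *)

Lemma is_Cseries_eps (a : nat -> C) (l : C) :
  is_Cseries a l <->
  forall eps : posreal, exists N : nat, forall n : nat,
    (N <= n)%nat -> Cmod (sum_n a n - l) < eps.
Proof.
  split.
  - intros H eps.
    destruct (H (fun y => Cmod (y - l) < eps)
      (locally_le_locally_norm (V := C_NormedModule) l _ (ex_intro _ eps (fun y Hy => Hy)))) as [N HN].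
    exists N. exact HN.
  - intros H P HP.
    destruct (locally_norm_le_locally (V := C_NormedModule) l P HP) as [eps Heps].
    destruct (H eps) as [N HN]. exists N. intros n Hn. apply Heps. exact (HN n Hn).
Qed.

Lemma fst_sum_n (a : nat -> C) (n : nat) :
  fst (sum_n a n) = sum_n (fun k => fst (a k)) n.
Proof.
  induction n as [|n IH]; [now rewrite !sum_O|].
  rewrite !sum_Sn, <- IH. reflexivity.
Qed.

Lemma snd_sum_n (a : nat -> C) (n : nat) :
  snd (sum_n a n) = sum_n (fun k => snd (a k)) n.
Proof.
  induction n as [|n IH]; [now rewrite !sum_O|].
  rewrite !sum_Sn, <- IH. reflexivity.
Qed.

Lemma is_series_eps (a : nat -> R) (l : R) :
  is_series a l <->
  forall eps : posreal, exists N : nat, forall n : nat,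
    (N <= n)%nat -> Rabs (sum_n a n - l) < eps.
Proof. exact (iff_sym (is_lim_seq_spec (sum_n a) l)). Qed.

Lemma is_Cseries_pair (a : nat -> C) (l : C) :
  is_Cseries a l <->
  is_series (fun n => fst (a n)) (fst l) /\ is_series (fun n => snd (a n)) (snd l).
Proof.
  rewrite is_Cseries_eps, !is_series_eps. split.
  - intros H; split; intros eps; destruct (H eps) as [N HN]; exists N; intros n Hn;
      eapply Rle_lt_trans; [|apply (HN n Hn)| |apply (HN n Hn)].
    + rewrite <- fst_sum_n. apply (Rabs_fst_le (sum_n a n - l)%C).
    + rewrite <- snd_sum_n. apply (Rabs_snd_le (sum_n a n - l)%C).
  - intros [H1 H2] eps.
    destruct (H1 (pos_div_2 eps)) as [N1 HN1].
    destruct (H2 (pos_div_2 eps)) as [N2 HN2].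
    exists (max N1 N2). intros n Hn.
    specialize (HN1 n ltac:(lia)). specialize (HN2 n ltac:(lia)). simpl in HN1, HN2.
    rewrite <- fst_sum_n in HN1. rewrite <- snd_sum_n in HN2.
    eapply Rle_lt_trans; [apply Cmod_le_sum|].
    exact (Rlt_le_trans _ _ _ (Rplus_lt_compat _ _ _ _ HN1 HN2) (Req_le _ _ (Rplus_half_diag eps))).
Qed.

Lemma is_Cseries_unique (a : nat -> C) (l l' : C) :
  is_Cseries a l -> is_Cseries a l' -> l = l'.
Proof.
  rewrite !is_Cseries_pair. intros [A1 A2] [B1 B2].
  apply is_series_unique in A1, A2, B1, B2.
  apply injective_projections; congruence.
Qed.

Lemma is_Cseries_ext (a b : nat -> C) (l : C) :
  (forall n, a n = b n) -> is_Cseries a l -> is_Cseries b l.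
Proof. apply is_series_ext. Qed.

Lemma is_Cseries_plus (a b : nat -> C) (la lb : C) :
  is_Cseries a la -> is_Cseries b lb -> is_Cseries (fun n => a n + b n)%C (la + lb)%C.
Proof. exact (is_series_plus (V := C_NormedModule) a b la lb). Qed.

Lemma is_Cseries_minus (a b : nat -> C) (la lb : C) :
  is_Cseries a la -> is_Cseries b lb -> is_Cseries (fun n => a n - b n)%C (la - lb)%C.
Proof. exact (is_series_minus (V := C_NormedModule) a b la lb). Qed.

Lemma is_Cseries_scal (c : C) (a : nat -> C) (l : C) :
  is_Cseries a l -> is_Cseries (fun n => c * a n)%C (c * l)%C.
Proof. exact (is_series_scal (V := C_NormedModule) c a l). Qed.

Lemma is_Cseries_decr_1 (a : nat -> C) (l : C) :
  is_Cseries (fun n => a (S n)) l -> is_Cseries a (a O + l)%C.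
Proof.
  intros H. apply (is_series_decr_1 (V := C_NormedModule)).
  match goal with |- is_series _ ?x => replace x with l; [exact H|] end.
  change (l = (a O + l) + - a O)%C. ring.
Qed.

Lemma is_Cseries_incr_1 (a : nat -> C) (l : C) :
  is_Cseries a l -> is_Cseries (fun n => a (S n)) (l - a O)%C.
Proof.
  intros H. apply (is_series_incr_1 (V := C_NormedModule)).
  match goal with |- is_series _ ?x => replace x with l; [exact H|] end.
  change (l = (l - a O) + a O)%C. ring.
Qed.

Lemma is_Cseries_RtoC (a : nat -> R) (l : R) :
  is_series a l -> is_Cseries (fun n => RtoC (a n)) (RtoC l).
Proof.
  intros H. apply is_Cseries_pair. split; simpl; [exact H|].
  apply is_series_eps. intros eps. exists O. intros n _.
  rewrite sum_n_const. rewrite Rmult_0_r, Rminus_0_r, Rabs_R0. apply cond_pos.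
Qed.

Lemma Cmod_sum_n_le (a : nat -> C) (n : nat) :
  Cmod (sum_n a n) <= sum_n (fun k => Cmod (a k)) n.
Proof.
  induction n as [|n IH]; [rewrite !sum_O; lra|].
  rewrite !sum_Sn. eapply Rle_trans; [apply Cmod_triangle|].
  unfold plus; simpl. lra.
Qed.

Lemma Cmod_sum_n_minus_le (a : nat -> C) (m n : nat) :
  (m <= n)%nat ->
  Cmod (sum_n a n - sum_n a m) <= sum_n (fun k => Cmod (a k)) n - sum_n (fun k => Cmod (a k)) m.
Proof.
  intros H. induction H as [|n H IH].
  - replace (sum_n a m - sum_n a m)%C with (RtoC 0) by ring. rewrite Cmod_0. lra.
  - rewrite !sum_Sn. unfold plus; simpl.
    replace (sum_n a n + a (S n) - sum_n a m)%C
      with ((sum_n a n - sum_n a m) + a (S n))%C by ring.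
    eapply Rle_trans; [apply Cmod_triangle|]. lra.
Qed.

Lemma Cmod_series_le (a : nat -> C) (b : nat -> R) (l : C) (m : R) :
  (forall n, Cmod (a n) <= b n) -> is_Cseries a l -> is_series b m -> Cmod l <= m.
Proof.
  intros Hab Ha Hb.
  apply Rnot_lt_le. intros Hlt.
  assert (He : 0 < (Cmod l - m) / 2) by lra.
  destruct (proj1 (is_Cseries_eps a l) Ha (mkposreal _ He)) as [N HN].
  destruct (proj1 (is_series_eps b m) Hb (mkposreal _ He)) as [N' HN'].
  specialize (HN (N + N')%nat ltac:(lia)). specialize (HN' (N + N')%nat ltac:(lia)).
  simpl in HN, HN'. apply Rabs_lt_between in HN'.
  assert (H1 : Cmod (sum_n a (N + N')) <= sum_n b (N + N')).
  { eapply Rle_trans; [apply Cmod_sum_n_le|].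
    generalize (N + N')%nat. intros n. induction n as [|n IH].
    - rewrite !sum_O. apply Hab.
    - rewrite !sum_Sn. apply Rplus_le_compat; [exact IH | apply Hab]. }
  assert (H2 : Cmod l <= Cmod (sum_n a (N + N')) + Cmod (sum_n a (N + N') - l)).
  { replace l with (sum_n a (N + N') + - (sum_n a (N + N') - l))%C at 1 by ring.
    eapply Rle_trans; [apply Cmod_triangle|]. rewrite Cmod_opp. lra. }
  lra.
Qed.

(** A total function, since the real [Series] is; its value is meaningful once convergence is
    known. *)
Definition CSeries (a : nat -> C) : C :=
  (Series (fun n => fst (a n)), Series (fun n => snd (a n))).

Lemma CSeries_correct (a : nat -> C) :
  ex_series (fun n => Cmod (a n)) -> is_Cseries a (CSeries a).
Proof.
  intros H. apply is_Cseries_pair. split; apply Series_correct;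
    apply (ex_series_le (V := R_CompleteNormedModule)) with (2 := H); intros n.
  - apply Rabs_fst_le.
  - apply Rabs_snd_le.
Qed.

Lemma ex_series_le_pos (a b : nat -> R) :
  (forall n, 0 <= a n <= b n) -> ex_series b -> ex_series a.
Proof.
  intros H. apply (ex_series_le (V := R_CompleteNormedModule)).
  intros n. unfold norm; simpl. unfold abs; simpl. rewrite Rabs_pos_eq; apply H.
Qed.

(** The tail keeps its original indices, padded with zeros, so that it can be compared term by term
    with another series over the same index. *)
Lemma is_series_tail (a : nat -> R) (l : R) (K : nat) :
  is_series a l ->
  is_series (fun n => if Compare_dec.le_dec n K then 0 else a n) (l - sum_n a K).
Proof.
  set (a' n := if Compare_dec.le_dec n K then 0 else a n).
  assert (E : forall n, (K <= n)%nat -> sum_n a' n + sum_n a K = sum_n a n).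
  { intros n Hn. induction Hn as [|n Hn IH].
    - rewrite (sum_n_ext_loc a' (fun _ => 0)).
      + rewrite sum_n_const. ring.
      + intros m Hm. unfold a'. destruct (Compare_dec.le_dec m K); [reflexivity|lia].
    - rewrite !sum_Sn, <- IH. unfold a' at 2.
      destruct (Compare_dec.le_dec (S n) K); [lia|]. unfold plus; simpl. ring. }
  assert (alg : forall x y z t : R, x + y = z -> x - (t - y) = z - t) by (intros; lra).
  rewrite !is_series_eps. intros H eps.
  destruct (H eps) as [N HN]. exists (max N K). intros n Hn.
  eapply Rle_lt_trans; [right; apply f_equal, alg, E; lia | apply HN; lia].
Qed.

(* Exchange of summations for a lower triangular array. The column sums up to K
   differ from the total by the tails of the rows of index > K only. *)
Lemma is_Cseries_triangular (b : nat -> nat -> C) (col : nat -> C) (s : C) :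
  (forall n k, (n < k)%nat -> b n k = 0) ->
  ex_series (fun n => sum_n (fun k => Cmod (b n k)) n) ->
  (forall k, is_Cseries (fun n => b n k) (col k)) ->
  is_Cseries (fun n => sum_n (b n) n) s ->
  is_Cseries col s.
Proof.
  intros Hb [m Hm] Hcol Hs.
  apply is_Cseries_eps. intros eps.
  destruct (proj1 (is_series_eps _ _) Hm eps) as [N HN].
  exists N. intros K HK.
  assert (Hc : is_Cseries (fun n => sum_n (b n) K) (sum_n col K)).
  { clear HK. induction K as [|K IH].
    - rewrite (sum_O col). apply is_Cseries_ext with (2 := Hcol O). intros n.
      rewrite sum_O. reflexivity.
    - rewrite (sum_Sn col). apply is_Cseries_ext with (2 := is_Cseries_plus _ _ _ _ IH (Hcol (S K))).
      intros n. rewrite sum_Sn. reflexivity. }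
  assert (Hd := is_Cseries_minus _ _ _ _ Hs Hc).
  assert (Ht := is_series_tail _ _ K Hm).
  assert (Hst : forall n K', (n <= K')%nat -> sum_n (b n) K' = sum_n (b n) n).
  { intros n K' HK'. induction HK' as [|K' HK' IH]; [reflexivity|].
    rewrite sum_Sn, IH, Hb by lia. apply (Cplus_0_r (sum_n (b n) n)). }
  assert (Habs : forall n (J : nat), (J <= n)%nat ->
     Cmod (sum_n (b n) n - sum_n (b n) J) <= sum_n (fun k => Cmod (b n k)) n).
  { intros n J HJ.
    assert (H := Cmod_sum_n_minus_le (b n) J n HJ).
    assert (0 <= sum_n (fun k => Cmod (b n k)) J).
    { eapply Rle_trans; [apply Cmod_ge_0 | apply (Cmod_sum_n_le (b n))]. }
    lra. }
  assert (Hle : Cmod (s - sum_n col K) <= m - sum_n (fun n => sum_n (fun k => Cmod (b n k)) n) K).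
  { apply (Cmod_series_le _ _ _ _) with (2 := Hd) (3 := Ht). intros n. simpl.
    destruct (Compare_dec.le_dec n K) as [H|H].
    - rewrite (Hst n K H).
      replace (sum_n (b n) n - sum_n (b n) n)%C with (RtoC 0) by ring. rewrite Cmod_0. lra.
    - apply Habs. lia. }
  specialize (HN K HK). apply Rabs_lt_between in HN.
  rewrite <- Cmod_opp.
  replace (- (sum_n col K - s))%C with (s - sum_n col K)%C by ring. lra.
Qed.

(** * Complex power series *)

(* Equations between values of [sum_n] live in the carrier of [C_AbelianMonoid],
   which [ring] does not recognise as [C]. *)
Ltac Cring := cbv beta; match goal with |- @eq _ ?x ?y => change (@eq C x y) end; ring.

Definition is_Cpseries (a : nat -> C) (z l : C) : Prop :=
  is_Cseries (fun n => a n * z ^ n)%C l.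

(** Coefficients, radius and function are tied together so that identities pass freely between
    coefficients and values. Absolute convergence at smaller radii is derived in
    [has_series_abs]. *)
Definition has_series (a : nat -> C) (rho : R) (F : C -> C) : Prop :=
  forall z : C, Cmod z < rho -> is_Cpseries a z (F z).

Definition CPS (a : nat -> C) (z : C) : C := CSeries (fun n => a n * z ^ n)%C.

Lemma pow_n_Cpow (z : C) (n : nat) : pow_n (K := C_Ring) z n = (z ^ n)%C.
Proof.
  induction n as [|n IH]; [reflexivity|].
  change (Cmult z (pow_n (K := C_Ring) z n) = (z ^ S n)%C).
  now rewrite IH, Cpow_S.
Qed.

Lemma is_pseries_Cpseries (a : nat -> C) (z l : C) :
  is_pseries (K := C_AbsRing) (V := C_NormedModule) a z l <-> is_Cpseries a z l.
Proof.
  assert (E : forall n, (pow_n (K := C_Ring) z n * a n)%C = (a n * z ^ n)%C)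
    by (intros n; rewrite pow_n_Cpow; ring).
  split; apply is_Cseries_ext; intros n; [|symmetry]; exact (E n).
Qed.

(** Both components of the terms tend to 0, so eventually each is below 1 and the modulus below 2;
    the finitely many earlier terms are bounded by their maximum. *)
Lemma is_Cpseries_bounded (a : nat -> C) (z l : C) :
  is_Cpseries a z l -> exists M, forall n, Cmod (a n) * Cmod z ^ n <= M.
Proof.
  intros H.
  assert (L1 : is_lim_seq (fun n => fst (a n * z ^ n)%C) 0)
    by (apply ex_series_lim_0; eexists; apply is_Cseries_pair, H).
  assert (L2 : is_lim_seq (fun n => snd (a n * z ^ n)%C) 0)
    by (apply ex_series_lim_0; eexists; apply is_Cseries_pair, H).
  apply is_lim_seq_spec in L1, L2.
  destruct (L1 (mkposreal 1 Rlt_0_1)) as [N1 HN1].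
  destruct (L2 (mkposreal 1 Rlt_0_1)) as [N2 HN2].
  assert (Hfin : forall N, exists M, forall n, (n < N)%nat -> Cmod (a n) * Cmod z ^ n <= M).
  { induction N as [|N [M HM]]; [exists 0; intros n Hn; lia|].
    exists (Rmax M (Cmod (a N) * Cmod z ^ N)). intros n Hn.
    destruct (PeanoNat.Nat.eq_dec n N) as [->|Hne]; [apply Rmax_r|].
    eapply Rle_trans; [apply HM; lia | apply Rmax_l]. }
  destruct (Hfin (max N1 N2)) as [M HM].
  exists (Rmax M 2). intros n.
  destruct (Compare_dec.le_lt_dec (max N1 N2) n) as [Hn|Hn].
  - eapply Rle_trans; [|apply Rmax_r].
    specialize (HN1 n ltac:(lia)). specialize (HN2 n ltac:(lia)).
    rewrite Rminus_0_r in HN1, HN2. simpl pos in HN1, HN2.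
    rewrite <- Cmod_pow, <- Cmod_mult.
    eapply Rle_trans; [apply Cmod_le_sum|]. lra.
  - eapply Rle_trans; [apply HM, Hn | apply Rmax_l].
Qed.

(** Abel's lemma: comparison with the geometric series of ratio [s / r]. *)
Lemma ex_series_pow_bounded (a : nat -> R) (M r s : R) :
  (forall n, 0 <= a n) -> (forall n, a n * r ^ n <= M) -> 0 <= s < r ->
  ex_series (fun n => a n * s ^ n).
Proof.
  intros Ha HM [Hs Hr].
  apply ex_series_le_pos with (b := fun n => M * (s / r) ^ n).
  - intros n. assert (0 <= s ^ n) by now apply pow_le.
    assert (Hrn : 0 < r ^ n) by (apply pow_lt; lra). split.
    + apply Rmult_le_pos; auto.
    + unfold Rdiv. rewrite Rpow_mult_distr, pow_inv.
      replace (a n * s ^ n) with (a n * r ^ n * (s ^ n * / r ^ n)) by (field; lra).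
      apply Rmult_le_compat_r; [|apply HM].
      apply Rmult_le_pos; [lra | left; now apply Rinv_0_lt_compat].
  - apply (ex_series_scal_l M (fun n => (s / r) ^ n)). apply ex_series_geom.
    rewrite Rabs_pos_eq; [apply (Rlt_div_l s 1 r); lra|].
    apply Rmult_le_pos; [lra | left; apply Rinv_0_lt_compat; lra].
Qed.

Lemma has_series_abs (a : nat -> C) (rho : R) (F : C -> C) (s : R) :
  has_series a rho F -> 0 <= s < rho -> ex_series (fun n => Cmod (a n) * s ^ n).
Proof.
  intros H Hs.
  (* A point strictly between [s] and [rho]: convergence there bounds the terms, and Abel's lemma
     moves in to [s]. *)
  assert (Hz : Cmod (RtoC ((s + rho) / 2)) = (s + rho) / 2).
  { rewrite Cmod_R, Rabs_pos_eq; lra. }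
  destruct (is_Cpseries_bounded a (RtoC ((s + rho) / 2)) _ (H (RtoC ((s + rho) / 2)) ltac:(lra))) as [M HM].
  rewrite Hz in HM.
  apply ex_series_pow_bounded with (M := M) (2 := HM); [|lra].
  intros n. apply Cmod_ge_0.
Qed.

Lemma has_series_CPS (a : nat -> C) (rho : R) :
  (forall s, 0 <= s < rho -> ex_series (fun n => Cmod (a n) * s ^ n)) ->
  has_series a rho (CPS a).
Proof.
  intros H z Hz. apply CSeries_correct.
  eapply ex_series_ext; [|apply (H (Cmod z))].
  - intros n. simpl. now rewrite Cmod_mult, Cmod_pow.
  - split; [apply Cmod_ge_0 | exact Hz].
Qed.

Lemma has_series_ext (a b : nat -> C) (rho : R) (F G : C -> C) :
  (forall n, a n = b n) -> (forall z, Cmod z < rho -> F z = G z) ->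
  has_series a rho F -> has_series b rho G.
Proof.
  intros Hab HFG H z Hz. rewrite <- HFG by exact Hz.
  apply is_Cseries_ext with (2 := H z Hz). intros n. now rewrite Hab.
Qed.

Lemma has_series_unique (a : nat -> C) (rho : R) (F G : C -> C) (z : C) :
  has_series a rho F -> has_series a rho G -> Cmod z < rho -> F z = G z.
Proof.
  intros HF HG Hz. exact (is_Cseries_unique _ _ _ (HF z Hz) (HG z Hz)).
Qed.

Lemma has_series_le (a : nat -> C) (r rho : R) (F : C -> C) :
  r <= rho -> has_series a rho F -> has_series a r F.
Proof. intros Hr H z Hz. apply H. lra. Qed.

Lemma has_series_minus (a b : nat -> C) (rho : R) (F G : C -> C) :
  has_series a rho F -> has_series b rho G ->
  has_series (fun n => a n - b n)%C rho (fun z => F z - G z)%C.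
Proof.
  intros HF HG z Hz.
  eapply is_Cseries_ext; [|exact (is_Cseries_minus _ _ _ _ (HF z Hz) (HG z Hz))].
  intros n. simpl. ring.
Qed.

Lemma has_series_scal (c : C) (a : nat -> C) (rho : R) (F : C -> C) :
  has_series a rho F -> has_series (fun n => c * a n)%C rho (fun z => c * F z)%C.
Proof.
  intros HF z Hz.
  eapply is_Cseries_ext; [|exact (is_Cseries_scal c _ _ (HF z Hz))].
  intros n. simpl. ring.
Qed.

Lemma is_Cpseries_0 (a : nat -> C) : is_Cpseries a 0 (a O).
Proof.
  replace (a O) with (a O * 0 ^ O + 0)%C by (simpl; ring).
  apply (is_Cseries_decr_1 (fun n => a n * 0 ^ n)%C).
  apply is_Cseries_ext with (a := fun _ => RtoC 0).
  - intros n. rewrite Cpow_S. ring.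
  - apply (is_Cseries_RtoC (fun _ => 0)). apply is_series_eps.
    intros eps. exists O. intros n _.
    rewrite sum_n_const, Rmult_0_r, Rminus_0_r, Rabs_R0. apply cond_pos.
Qed.

Lemma has_series_at_0 (a : nat -> C) (rho : R) (F : C -> C) :
  0 < rho -> has_series a rho F -> F 0 = a O.
Proof.
  intros Hr H. apply (is_Cseries_unique (fun n => a n * 0 ^ n)%C); [|apply is_Cpseries_0].
  apply H. rewrite Cmod_0. exact Hr.
Qed.

Lemma has_series_mul_z (a : nat -> C) (rho : R) (F : C -> C) :
  has_series (fun n => a (S n)) rho F -> a O = 0 ->
  has_series a rho (fun z => z * F z)%C.
Proof.
  intros H H0 z Hz.
  replace (z * F z)%C with (a O * z ^ O + z * F z)%C by (rewrite H0; simpl; ring).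
  apply (is_Cseries_decr_1 (fun n => a n * z ^ n)%C).
  eapply is_Cseries_ext; [|exact (is_Cseries_scal z _ _ (H z Hz))].
  intros n. simpl. ring.
Qed.

(** The value [a 1] at 0 fills the removable singularity, so the shifted series represents the
    quotient on the whole disc, 0 included. *)
Lemma has_series_div_z (a : nat -> C) (rho : R) (F : C -> C) :
  has_series a rho F -> a O = 0 ->
  has_series (fun n => a (S n)) rho (fun z => if Ceq_dec z 0 then a 1%nat else F z / z)%C.
Proof.
  intros H H0 z Hz. destruct (Ceq_dec z 0) as [->|Hnz].
  - exact (is_Cpseries_0 (fun n => a (S n))).
  - assert (H1 := is_Cseries_scal (/ z) _ _ (is_Cseries_incr_1 _ _ (H z Hz))).
    simpl in H1. rewrite H0 in H1.
    replace (/ z * (F z - 0 * 1))%C with (F z / z)%C in H1 by (field; exact Hnz).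
    eapply is_Cseries_ext; [|exact H1]. intros n. simpl. field. exact Hnz.
Qed.

(** The tail of the series carries a factor [w ^ 2]; what remains is dominated by the absolutely
    convergent series at [rho / 2], whose sum is [K]. Differentiability at 0 and the isolation of
    zeros both rest on this estimate. *)
Lemma has_series_quadratic (b : nat -> C) (rho : R) (F : C -> C) :
  0 < rho -> has_series b rho F ->
  exists K, 0 <= K /\ forall w, Cmod w <= rho / 2 -> Cmod (F w - b O - w * b 1%nat) <= K * Cmod w ^ 2.
Proof.
  intros Hr H.
  destruct (has_series_abs b rho F (rho / 2) H ltac:(lra)) as [m Hm].
  assert (E : ex_series (fun n => Cmod (b (S (S n))) * (rho / 2) ^ n)).
  { apply ex_series_ext with (fun n => / (rho / 2) ^ 2 * (Cmod (b (S (S n))) * (rho / 2) ^ (S (S n)))).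
    - intros n. simpl. field. lra.
    - apply (ex_series_scal_l (/ (rho / 2) ^ 2) (fun n => Cmod (b (S (S n))) * (rho / 2) ^ (S (S n)))).
      apply (ex_series_incr_1 (fun n => Cmod (b (S n)) * (rho / 2) ^ S n)).
      apply (ex_series_incr_1 (fun n => Cmod (b n) * (rho / 2) ^ n)).
      now exists m. }
  destruct E as [K HK]. exists K.
  assert (HE : forall w, Cmod w <= rho / 2 -> Cmod (F w - b O - w * b 1%nat) <= K * Cmod w ^ 2).
  { intros w Hw.
    apply Cmod_series_le with (a := fun n => (b (S (S n)) * w ^ (S (S n)))%C)
      (b := fun n => Cmod (b (S (S n))) * (rho / 2) ^ n * Cmod w ^ 2).
    - intros n. rewrite Cmod_mult, Cmod_pow.
      replace (Cmod w ^ S (S n)) with (Cmod w ^ n * Cmod w ^ 2) by (simpl; ring).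
      rewrite Rmult_assoc.
      apply Rmult_le_compat_l; [apply Cmod_ge_0|].
      apply Rmult_le_compat_r; [apply pow2_ge_0|].
      apply pow_incr. split; [apply Cmod_ge_0 | exact Hw].
    - assert (H1 := is_Cseries_incr_1 _ _ (is_Cseries_incr_1 _ _ (H w ltac:(lra)))).
      simpl in H1.
      replace (F w - b O - w * b 1%nat)%C with (F w - b 0%nat * 1 - b 1%nat * (w * 1))%C by ring.
      exact H1.
    - now apply is_series_scal_r. }
  split; [|exact HE].
  eapply Rle_trans; [apply (Cmod_ge_0 (CSeries (fun n => RtoC (Cmod (b (S (S n))) * (rho / 2) ^ n))))|].
  apply Cmod_series_le with (a := fun n => RtoC (Cmod (b (S (S n))) * (rho / 2) ^ n)) (3 := HK).
  - intros n. rewrite Cmod_R, Rabs_pos_eq; [lra|].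
    apply Rmult_le_pos; [apply Cmod_ge_0 | apply pow_le; lra].
  - apply CSeries_correct. exists K. eapply is_series_ext; [|exact HK].
    intros n. simpl. rewrite Cmod_R, Rabs_pos_eq; [reflexivity|].
    apply Rmult_le_pos; [apply Cmod_ge_0 | apply pow_le; lra].
Qed.

Lemma has_series_derive_0 (b : nat -> C) (rho : R) (F : C -> C) :
  0 < rho -> has_series b rho F -> is_Cderive F (RtoC 0) (b 1%nat).
Proof.
  intros Hr H. apply is_Cderive_eps. intros eps.
  destruct (has_series_quadratic b rho F Hr H) as [K [HK0 HK]].
  rewrite (has_series_at_0 b rho F Hr H).
  assert (Hd : 0 < Rmin (rho / 2) (eps / (K + 1))).
  { apply Rmin_pos; [lra|]. apply Rdiv_lt_0_compat; [apply cond_pos | lra]. }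
  exists (mkposreal _ Hd). intros y Hy. simpl in Hy.
  assert (H1 := Rlt_le_trans _ _ _ Hy (Rmin_l _ _)).
  assert (H2 := Rlt_le_trans _ _ _ Hy (Rmin_r _ _)).
  replace (y - 0)%C with y in * by ring.
  eapply Rle_trans; [apply HK; lra|].
  apply (Rmult_lt_compat_l (K + 1)) in H2; [|lra].
  replace ((K + 1) * (eps / (K + 1))) with (pos eps) in H2 by (field; lra).
  assert (H3 := Cmod_ge_0 y). simpl. nra.
Qed.

(** Zeros accumulating at 0 kill the constant coefficient by continuity. Dividing by z keeps the
    nonzero zeros and shifts the coefficients, so the induction on [k] must leave the series and the
    function free. *)
Lemma has_series_zeros (k : nat) : forall (d : nat -> C) (rho : R) (D : C -> C),
  0 < rho -> has_series d rho D ->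
  (forall eps, 0 < eps -> exists w : C, w <> 0 /\ Cmod w < eps /\ D w = 0) ->
  d k = 0.
Proof.
  assert (H0 : forall (d : nat -> C) (rho : R) (D : C -> C),
    0 < rho -> has_series d rho D ->
    (forall eps, 0 < eps -> exists w : C, w <> 0 /\ Cmod w < eps /\ D w = 0) -> d O = 0).
  { intros d rho D Hr H Hz. apply Cmod_eq_0.
    destruct (has_series_quadratic d rho D Hr H) as [K [HK0 HK]].
    apply Rle_antisym; [|apply Cmod_ge_0].
    apply Rnot_lt_le. intros Hpos.
    (* For |w| at most [rho / 2] the function differs from [d 0] by at most [A] |w|, so a zero
       closer than [Cmod (d 0) / (A + 1)] is contradictory. *)
    set (A := Cmod (d 1%nat) + K * (rho / 2)).
    assert (HA : 0 <= A).
    { apply Rplus_le_le_0_compat; [apply Cmod_ge_0 | apply Rmult_le_pos; lra]. }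
    destruct (Hz (Rmin (rho / 2) (Cmod (d O) / (A + 1)))) as [w [_ [Hw HD]]].
    { apply Rmin_pos; [lra|]. apply Rdiv_lt_0_compat; lra. }
    assert (H1 := Rlt_le_trans _ _ _ Hw (Rmin_l _ _)).
    assert (H2 := Rlt_le_trans _ _ _ Hw (Rmin_r _ _)).
    specialize (HK w ltac:(lra)). rewrite HD in HK.
    assert (H3 := Cmod_ge_0 w).
    assert (H4 : Cmod (d O) <= Cmod w * Cmod (d 1%nat) + K * Cmod w ^ 2).
    { replace (d O) with (- (w * d 1%nat) + - (0 - d O - w * d 1%nat))%C at 1 by ring.
      eapply Rle_trans; [apply Cmod_triangle|].
      rewrite !Cmod_opp, Cmod_mult. lra. }
    apply (Rmult_lt_compat_l (A + 1)) in H2; [|lra].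
    replace ((A + 1) * (Cmod (d O) / (A + 1))) with (Cmod (d O)) in H2 by (field; lra).
    assert (K * Cmod w ^ 2 <= K * (rho / 2) * Cmod w).
    { rewrite Rmult_assoc. apply Rmult_le_compat_l; [exact HK0|]. simpl. nra. }
    unfold A in H2. nra. }
  induction k as [|k IH]; [exact H0|].
  intros d rho D Hr H Hz.
  apply (IH (fun n => d (S n)) rho _ Hr (has_series_div_z d rho D H (H0 d rho D Hr H Hz))).
  intros eps He. destruct (Hz eps He) as [w [Hw [Hw1 HD]]].
  exists w. repeat split; [exact Hw | exact Hw1|].
  destruct (Ceq_dec w 0) as [E|_]; [contradiction|]. rewrite HD. unfold Cdiv. ring.
Qed.

Lemma has_series_coef_unique (a b : nat -> C) (r : R) (F : C -> C) (k : nat) :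
  0 < r -> has_series a r F -> has_series b r F -> a k = b k.
Proof.
  intros Hr Ha Hb.
  assert (H := has_series_minus _ _ _ _ _ Ha Hb).
  assert (E : (a k - b k)%C = 0).
  { apply (has_series_zeros k _ _ _ Hr H).
    intros eps He.
    assert (Hm : 0 < Rmin 1 eps) by (apply Rmin_pos; lra).
    exists (RtoC (Rmin 1 eps / 2)). repeat split.
    - intros E. apply (f_equal fst) in E. simpl in E. lra.
    - rewrite Cmod_R, Rabs_pos_eq by lra. assert (Rmin 1 eps <= eps) by apply Rmin_r. lra.
    - ring. }
  replace (a k) with (a k - b k + b k)%C by ring. rewrite E. ring.
Qed.

(** * Cauchy products and recentring *)

Definition conv (a b : nat -> C) (n : nat) : C :=
  sum_n (fun k => a k * b (n - k)%nat)%C n.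

Lemma Csum_n_scal (c : C) (a : nat -> C) (n : nat) :
  sum_n (fun k => c * a k)%C n = (c * sum_n a n)%C.
Proof. exact (sum_n_mult_l (K := C_Ring) c a n). Qed.

(** The products form the triangular array [t n k], equal to [a k * b (n - k)] on and below the
    diagonal. Its rows sum to [conv a b n], its columns to [a k * lb], and exchanging the summations
    gives the product. *)
Lemma is_Cseries_mult (a b : nat -> C) (la lb : C) :
  ex_series (fun n => Cmod (a n)) -> ex_series (fun n => Cmod (b n)) ->
  is_Cseries a la -> is_Cseries b lb -> is_Cseries (conv a b) (la * lb)%C.
Proof.
  intros Ha Hb Hla Hlb.
  set (t n k := if Compare_dec.le_dec k n then (a k * b (n - k)%nat)%C else RtoC 0).
  assert (Hrow : forall n, sum_n (t n) n = conv a b n).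
  { intros n. apply sum_n_ext_loc. intros k Hk. unfold t.
    destruct (Compare_dec.le_dec k n); [reflexivity|lia]. }
  assert (Habs : ex_series (fun n => sum_n (fun k => Cmod (t n k)) n)).
  { destruct Ha as [ma Hma]. destruct Hb as [mb Hmb].
    exists (ma * mb).
    eapply is_series_ext; [|apply (is_series_mult_pos _ _ _ _ Hma Hmb)].
    - intros n. simpl. rewrite <- sum_n_Reals. apply sum_n_ext_loc. intros k Hk. unfold t.
      destruct (Compare_dec.le_dec k n); [|lia]. now rewrite Cmod_mult.
    - intros n. apply Cmod_ge_0.
    - intros n. apply Cmod_ge_0. }
  (* The sum by rows exists by absolute convergence; its value is identified only at the end,
     through the columns. *)
  assert (Hsum : is_Cseries (fun n => sum_n (t n) n) (CSeries (fun n => sum_n (t n) n))).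
  { apply CSeries_correct. apply ex_series_le_pos with (2 := Habs). intros n.
    split; [apply Cmod_ge_0 | apply Cmod_sum_n_le]. }
  assert (Hcol : forall k, is_Cseries (fun n => t n k) (a k * lb)%C).
  { intros k.
    assert (Hs : is_Cseries (fun n => if Compare_dec.le_dec k n then b (n - k)%nat else RtoC 0) lb).
    { clear - Hlb. induction k as [|k IH].
      - apply is_Cseries_ext with (2 := Hlb). intros n. simpl.
        now rewrite PeanoNat.Nat.sub_0_r.
      - replace lb with ((if Compare_dec.le_dec (S k) 0 then b (0 - S k)%nat else RtoC 0) + lb)%C
          by (simpl; ring).
        apply (is_Cseries_decr_1 (fun n => if Compare_dec.le_dec (S k) n then b (n - S k)%nat else RtoC 0)).
        apply is_Cseries_ext with (2 := IH). intros n.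
        destruct (Compare_dec.le_dec k n), (Compare_dec.le_dec (S k) (S n)); try lia; reflexivity. }
    eapply is_Cseries_ext; [|exact (is_Cseries_scal (a k) _ _ Hs)].
    intros n. unfold t. simpl. destruct (Compare_dec.le_dec k n); ring. }
  assert (Ht : forall n k, (n < k)%nat -> t n k = 0).
  { intros n k Hk. unfold t. destruct (Compare_dec.le_dec k n); [lia|reflexivity]. }
  assert (H := is_Cseries_triangular t _ _ Ht Habs Hcol Hsum).
  assert (H' : is_Cseries (fun k => a k * lb)%C (la * lb)%C).
  { rewrite (Cmult_comm la lb). eapply is_Cseries_ext; [|exact (is_Cseries_scal lb _ _ Hla)].
    intros n. simpl. ring. }
  rewrite (is_Cseries_unique _ _ _ H' H).
  apply is_Cseries_ext with (2 := Hsum). exact Hrow.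
Qed.

Lemma has_series_mult (a b : nat -> C) (rho : R) (F G : C -> C) :
  has_series a rho F -> has_series b rho G ->
  has_series (conv a b) rho (fun z => F z * G z)%C.
Proof.
  intros HF HG z Hz.
  assert (Hz' : 0 <= Cmod z < rho) by (split; [apply Cmod_ge_0 | exact Hz]).
  eapply is_Cseries_ext; [|apply (is_Cseries_mult _ _ _ _)
    with (3 := HF z Hz) (4 := HG z Hz)].
  - intros n. unfold conv. rewrite Cmult_comm, <- Csum_n_scal.
    apply sum_n_ext_loc. intros k Hk.
    replace (z ^ n)%C with (z ^ k * z ^ (n - k))%C by (rewrite <- Cpow_add_r; f_equal; lia).
    Cring.
  - eapply ex_series_ext; [|exact (has_series_abs _ _ _ _ HF Hz')].
    intros n. simpl. now rewrite Cmod_mult, Cmod_pow.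
  - eapply ex_series_ext; [|exact (has_series_abs _ _ _ _ HG Hz')].
    intros n. simpl. now rewrite Cmod_mult, Cmod_pow.
Qed.

(* [shift_coef z n k] is the coefficient of [w ^ k] in [(z + w) ^ n]. *)
Fixpoint shift_coef (z : C) (n k : nat) : C :=
  match n, k with
  | O, O => 1
  | O, S _ => 0
  | S n', O => z * shift_coef z n' O
  | S n', S k' => z * shift_coef z n' k + shift_coef z n' k'
  end%C.

Lemma shift_coef_gt (z : C) (n k : nat) : (n < k)%nat -> shift_coef z n k = 0.
Proof.
  revert k. induction n as [|n IH]; intros [|k] Hk; try lia; [reflexivity|].
  simpl. rewrite !IH by lia. ring.
Qed.

Lemma shift_coef_0 (z : C) (n : nat) : shift_coef z n 0 = (z ^ n)%C.
Proof. induction n as [|n IH]; [reflexivity|]. simpl. now rewrite IH. Qed.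

Lemma shift_coef_1 (z : C) (n : nat) : shift_coef z (S n) 1 = (RtoC (INR (S n)) * z ^ n)%C.
Proof.
  induction n as [|n IH]; [simpl; ring|].
  change (z * shift_coef z (S n) 1 + shift_coef z (S n) 0 = RtoC (INR (S (S n))) * z ^ S n)%C.
  rewrite IH, shift_coef_0, (S_INR (S n)), RtoC_plus, Cpow_S. ring.
Qed.

Lemma sum_n_first (G : AbelianMonoid) (a : nat -> G) (n : nat) :
  sum_n a (S n) = plus (a O) (sum_n (fun k => a (S k)) n).
Proof.
  induction n as [|n IH].
  - now rewrite sum_Sn, !sum_O.
  - rewrite sum_Sn, IH, (sum_Sn (fun k => a (S k))). symmetry. apply plus_assoc.
Qed.

Lemma Csum_n_first (a : nat -> C) (n : nat) :
  sum_n a (S n) = (a O + sum_n (fun k => a (S k)) n)%C.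
Proof. exact (sum_n_first C_AbelianMonoid a n). Qed.

Lemma Rsum_n_first (a : nat -> R) (n : nat) :
  sum_n a (S n) = a O + sum_n (fun k => a (S k)) n.
Proof. exact (sum_n_first R_AbelianMonoid a n). Qed.

Lemma Rsum_n_scal (c : R) (a : nat -> R) (n : nat) :
  sum_n (fun k => c * a k) n = c * sum_n a n.
Proof. exact (sum_n_mult_l (K := R_Ring) c a n). Qed.

Lemma Rsum_n_le (a b : nat -> R) (n : nat) :
  (forall k, (k <= n)%nat -> a k <= b k) -> sum_n a n <= sum_n b n.
Proof.
  induction n as [|n IH]; intros H; [rewrite !sum_O; auto|].
  rewrite !sum_Sn. apply Rplus_le_compat; [apply IH; intros k Hk|]; apply H; lia.
Qed.

Lemma sum_shift_coef (z w : C) (n N : nat) :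
  (n <= N)%nat -> sum_n (fun k => shift_coef z n k * w ^ k)%C N = ((z + w) ^ n)%C.
Proof.
  revert N. induction n as [|n IH]; intros N HN.
  - induction N as [|N IHN]; [rewrite sum_O; simpl; ring|].
    rewrite sum_Sn, IHN by lia. simpl shift_coef.
    change (1 + 0 * w ^ S N = 1)%C. ring.
  - destruct N as [|N]; [lia|].
    rewrite Csum_n_first, Cpow_S.
    assert (E : sum_n (fun k => shift_coef z (S n) (S k) * w ^ S k)%C N =
      (z * sum_n (fun k => shift_coef z n (S k) * w ^ S k) N
       + w * sum_n (fun k => shift_coef z n k * w ^ k) N)%C).
    { rewrite <- !Csum_n_scal. rewrite <- (sum_n_plus (G := C_AbelianMonoid)).
      apply sum_n_ext. intros k. simpl. change (@plus C_AbelianMonoid) with Cplus. Cring. }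
    rewrite E, IH by lia.
    assert (E2 := IH (S N) ltac:(lia)). rewrite Csum_n_first in E2.
    rewrite Cmult_plus_distr_r, <- E2. simpl. ring.
Qed.

(** The triangle inequality in Pascal's recursion. It dominates the double series of the recentring
    by the series of [Cmod (a n) * (Cmod z + s) ^ n]. *)
Lemma sum_shift_coef_abs (z : C) (s : R) (n N : nat) :
  0 <= s ->
  sum_n (fun k => Cmod (shift_coef z n k) * s ^ k) N <= (Cmod z + s) ^ n.
Proof.
  intros Hs. revert N. induction n as [|n IH]; intros N.
  - induction N as [|N IHN]; [rewrite sum_O; simpl; rewrite Cmod_1; lra|].
    rewrite sum_Sn. simpl shift_coef. rewrite Cmod_0.
    eapply Rle_trans; [right; apply (f_equal (Rplus _)), Rmult_0_l | rewrite Rplus_0_r; exact IHN].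
  - assert (Hz := Cmod_ge_0 z). assert (Hp : 0 <= (Cmod z + s) ^ n) by (apply pow_le; lra).
    destruct N as [|N].
    + assert (H := IH O). rewrite sum_O in H |- *. simpl shift_coef. rewrite Cmod_mult.
      simpl in *. nra.
    + rewrite Rsum_n_first.
      assert (H1 := IH (S N)). rewrite Rsum_n_first in H1. assert (H2 := IH N).
      assert (H3 : sum_n (fun k => Cmod (shift_coef z (S n) (S k)) * s ^ S k) N <=
        Cmod z * sum_n (fun k => Cmod (shift_coef z n (S k)) * s ^ S k) N
        + s * sum_n (fun k => Cmod (shift_coef z n k) * s ^ k) N).
      { rewrite <- !Rsum_n_scal.
        eapply Rle_trans; [|right; apply (sum_n_plus (G := R_AbelianMonoid))].
        apply Rsum_n_le. intros k _. simpl.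
        assert (Ht := Cmod_triangle (z * shift_coef z n (S k)) (shift_coef z n k)).
        rewrite Cmod_mult in Ht.
        apply (Rmult_le_compat_r (s * s ^ k)) in Ht;
          [|apply Rmult_le_pos; [lra | now apply pow_le]].
        unfold plus; simpl. lra. }
      change (shift_coef z (S n) 0) with (z * shift_coef z n 0)%C. rewrite Cmod_mult.
      change ((Cmod z + s) ^ S n) with ((Cmod z + s) * (Cmod z + s) ^ n).
      apply (Rmult_le_compat_l (Cmod z)) in H1; [|exact Hz].
      apply (Rmult_le_compat_l s) in H2; [|exact Hs].
      lra.
Qed.

(** Expanding each [(z + w) ^ n] gives a triangular array whose rows sum to the given series and
    whose columns give the expansion at [z]. The second conclusion identifies the linear coefficient
    with the termwise derivative, so differentiation at any point reduces to differentiation at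
    0. *)
Lemma has_series_recenter (a : nat -> C) (rho : R) (F : C -> C) (z : C) :
  has_series a rho F -> Cmod z < rho ->
  exists b : nat -> C,
    has_series b (rho - Cmod z) (fun w => F (z + w)%C) /\
    is_Cpseries (fun n => RtoC (INR (S n)) * a (S n))%C z (b 1%nat).
Proof.
  intros H Hz. assert (Hz0 := Cmod_ge_0 z).
  set (s := (rho - Cmod z) / 2).
  assert (Hs : 0 < s) by (unfold s; lra).
  set (b k := CSeries (fun n => a n * shift_coef z n k)%C).
  assert (Hb : forall k, is_Cseries (fun n => a n * shift_coef z n k)%C (b k)).
  { intros k. apply CSeries_correct.
    assert (Hsk : 0 < s ^ k) by now apply pow_lt.
    (* A single term of the sum bounded by [(Cmod z + s) ^ n] yields the estimate of
       [shift_coef z n k] by [(Cmod z + s) ^ n / s ^ k]. *)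
    apply ex_series_le_pos with (b := fun n => / s ^ k * (Cmod (a n) * (Cmod z + s) ^ n)).
    - intros n. split; [apply Cmod_ge_0|].
      rewrite Cmod_mult.
      replace (/ s ^ k * (Cmod (a n) * (Cmod z + s) ^ n))
        with (Cmod (a n) * ((Cmod z + s) ^ n * / s ^ k)) by ring.
      apply Rmult_le_compat_l; [apply Cmod_ge_0|].
      apply Rmult_le_reg_r with (s ^ k); [exact Hsk|].
      rewrite Rmult_assoc, Rinv_l, Rmult_1_r by lra.
      eapply Rle_trans; [|apply (sum_shift_coef_abs z s n k); lra].
      assert (Hnn : forall m, 0 <= Cmod (shift_coef z n m) * s ^ m).
      { intros m. apply Rmult_le_pos; [apply Cmod_ge_0 | apply pow_le; lra]. }
      destruct k as [|k]; [rewrite sum_O; lra|].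
      rewrite sum_Sn.
      assert (0 <= sum_n (fun m => Cmod (shift_coef z n m) * s ^ m) k).
      { eapply Rle_trans; [|apply (Rsum_n_le (fun _ => 0)); intros m _; apply Hnn].
        rewrite sum_n_const. lra. }
      unfold plus; simpl in *; lra.
    - apply (ex_series_scal_l (/ s ^ k) (fun n => Cmod (a n) * (Cmod z + s) ^ n)).
      apply (has_series_abs a rho F); [exact H|]. unfold s. lra. }
  exists b. split.
  - intros w Hw. assert (Hw0 := Cmod_ge_0 w).
    apply (is_Cseries_triangular (fun n k => a n * (shift_coef z n k * w ^ k))%C).
    + intros n k Hk. rewrite shift_coef_gt by exact Hk. ring.
    + apply ex_series_le_pos with (b := fun n => Cmod (a n) * (Cmod z + Cmod w) ^ n).
      * intros n. split.
        -- eapply Rle_trans; [|apply (Rsum_n_le (fun _ => 0)); intros m _; apply Cmod_ge_0].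
           rewrite sum_n_const. lra.
        -- apply Rle_trans with (Cmod (a n) *
             sum_n (fun k => Cmod (shift_coef z n k) * Cmod w ^ k) n).
           ++ rewrite <- Rsum_n_scal. apply Rsum_n_le. intros k _.
              rewrite !Cmod_mult, Cmod_pow. lra.
           ++ apply Rmult_le_compat_l; [apply Cmod_ge_0|]. now apply sum_shift_coef_abs.
      * apply (has_series_abs a rho F); [exact H|]. lra.
    + intros k.
      replace (b k * w ^ k)%C with (w ^ k * b k)%C by ring.
      eapply is_Cseries_ext; [|exact (is_Cseries_scal (w ^ k)%C _ _ (Hb k))].
      intros n. simpl. ring.
    + assert (Hzw : Cmod (z + w) < rho) by (assert (Ht := Cmod_triangle z w); lra).
      apply is_Cseries_ext with (2 := H _ Hzw). intros n.
      rewrite Csum_n_scal, sum_shift_coef by lia. reflexivity.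
  (* The term n = 0 has no linear part; dropping it gives the index shift of the derivative
     series. *)
  - assert (H1 := is_Cseries_incr_1 _ _ (Hb 1%nat)). simpl in H1.
    replace (b 1%nat - a 0%nat * 0)%C with (b 1%nat) in H1 by ring.
    eapply is_Cseries_ext; [|exact H1]. intros n. cbv beta.
    change (z * shift_coef z n 1 + shift_coef z n 0)%C with (shift_coef z (S n) 1).
    rewrite shift_coef_1. ring.
Qed.

(** * Termwise differentiation and integration *)

Definition deriv_coef (a : nat -> C) (n : nat) : C := (RtoC (INR (S n)) * a (S n))%C.

Definition prim_coef (a : nat -> C) (n : nat) : C :=
  match n with O => 0 | S k => a k / RtoC (INR (S k)) end%C.

Lemma RtoC_INR_S_neq_0 (n : nat) : RtoC (INR (S n)) <> 0.
Proof. intros E. apply (f_equal fst) in E. simpl fst in E. now apply (not_0_INR (S n)) in E. Qed.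

Lemma deriv_prim_coef (a : nat -> C) (n : nat) : deriv_coef (prim_coef a) n = a n.
Proof. unfold deriv_coef, prim_coef. field. apply RtoC_INR_S_neq_0. Qed.

Lemma has_series_derive (a : nat -> C) (rho : R) (F : C -> C) (z : C) :
  has_series a rho F -> Cmod z < rho ->
  exists l, is_Cpseries (deriv_coef a) z l /\ is_Cderive F z l.
Proof.
  intros H Hz. destruct (has_series_recenter a rho F z H Hz) as [b [Hb Hb1]].
  exists (b 1%nat). split; [exact Hb1|].
  assert (Hd := has_series_derive_0 _ _ _ (proj2 (Rlt_0_minus _ _) Hz) Hb).
  rewrite is_Cderive_eps in Hd |- *. intros eps. destruct (Hd eps) as [d Hd'].
  exists d. intros y Hy. specialize (Hd' (y - z)%C).
  replace (y - z - 0)%C with (y - z)%C in Hd' by ring.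
  replace (z + (y - z))%C with y in Hd' by ring.
  replace (z + 0)%C with z in Hd' by ring. exact (Hd' Hy).
Qed.

Lemma has_series_is_derive (a : nat -> C) (rho : R) (F G : C -> C) (z : C) :
  has_series a rho F -> has_series (deriv_coef a) rho G -> Cmod z < rho ->
  is_Cderive F z (G z).
Proof.
  intros HF HG Hz. destruct (has_series_derive a rho F z HF Hz) as [l [Hl Hd]].
  now rewrite (is_Cseries_unique _ _ _ (HG z Hz) Hl).
Qed.

Lemma has_series_prim (a : nat -> C) (rho : R) (F : C -> C) :
  has_series a rho F -> has_series (prim_coef a) rho (CPS (prim_coef a)).
Proof.
  intros H. apply has_series_CPS. intros s Hs.
  apply ex_series_incr_1.
  apply ex_series_le_pos with (b := fun n => s * (Cmod (a n) * s ^ n)).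
  - intros n. assert (Hn := Cmod_ge_0 (a n)). assert (0 <= s ^ n) by (apply pow_le; lra).
    assert (0 <= s ^ S n) by (apply pow_le; lra).
    split; [apply Rmult_le_pos; [apply Cmod_ge_0 | assumption]|].
    unfold prim_coef. rewrite Cmod_div by apply RtoC_INR_S_neq_0.
    rewrite Cmod_R, Rabs_pos_eq by apply pos_INR.
    replace (s * (Cmod (a n) * s ^ n)) with (Cmod (a n) * s ^ S n) by (simpl; ring).
    apply Rmult_le_compat_r; [assumption|].
    apply Rle_div_l; [apply lt_0_INR; lia|].
    assert (1 <= INR (S n)) by (rewrite S_INR; assert (Hp := pos_INR n); lra). nra.
  - apply (ex_series_scal_l s (fun n => Cmod (a n) * s ^ n)).
    now apply (has_series_abs a rho F).
Qed.

Lemma has_series_analytic_at (a : nat -> C) (rho : R) (F : C -> C) (z : C) :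
  has_series a rho F -> Cmod z < rho -> analytic_at F z.
Proof.
  intros H Hz. destruct (has_series_recenter a rho F z H Hz) as [b [Hb _]].
  exists b. apply (locally_le_locally_norm (V := C_NormedModule)).
  exists (mkposreal _ (proj2 (Rlt_0_minus _ _) Hz)). intros y Hy. change C in y.
  apply is_pseries_Cpseries. specialize (Hb (y - z)%C Hy). cbv beta in Hb.
  now replace (z + (y - z))%C with y in Hb by ring.
Qed.

Lemma analytic_at_has_series (F : C -> C) (z : C) :
  analytic_at F z -> exists a rho, 0 < rho /\ has_series a rho (fun w => F (z + w)%C).
Proof.
  intros [a Ha]. apply (locally_norm_le_locally (V := C_NormedModule)) in Ha.
  destruct Ha as [rho Hr]. exists a, (pos rho). split; [apply cond_pos|].
  intros w Hw. assert (Hw' : Cmod (z + w - z) < rho) by now replace (z + w - z)%C with w by ring.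
  specialize (Hr (z + w)%C Hw'). apply is_pseries_Cpseries in Hr.
  now replace (z + w - z)%C with w in Hr by ring.
Qed.

(** * Line integrals and the decaying spiral *)

Lemma Ccontinuous_pair (f : R -> C) (t : R) :
  continuous (T := R_UniformSpace) (U := C_UniformSpace) f t <->
  continuous (fun s => fst (f s)) t /\ continuous (fun s => snd (f s)) t.
Proof.
  split.
  - intros H. split.
    + apply (continuous_comp f fst); [exact H | apply continuous_fst].
    + apply (continuous_comp f snd); [exact H | apply continuous_snd].
  - intros [H1 H2]. apply (filterlim_locally (U := C_UniformSpace)). intros eps.
    apply (filterlim_locally (fun s => fst (f s))) with (eps := eps) in H1.
    apply (filterlim_locally (fun s => snd (f s))) with (eps := eps) in H2.
    generalize (filter_and _ _ H1 H2). apply filter_imp. intros s Hs. exact Hs.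
Qed.

Lemma Ccontinuous_mult (f g : R -> C) (t : R) :
  continuous (T := R_UniformSpace) (U := C_UniformSpace) f t ->
  continuous (T := R_UniformSpace) (U := C_UniformSpace) g t ->
  continuous (T := R_UniformSpace) (U := C_UniformSpace) (fun s => f s * g s)%C t.
Proof.
  rewrite !Ccontinuous_pair. intros [F1 F2] [G1 G2]. split.
  - apply (continuous_minus (V := R_NormedModule)); now apply (continuous_mult (K := R_AbsRing)).
  - apply (continuous_plus (V := R_NormedModule)); now apply (continuous_mult (K := R_AbsRing)).
Qed.

Lemma is_Rderive_continuous (f : R -> C) (t : R) (l : C) :
  is_Rderive f t l -> continuous (T := R_UniformSpace) (U := C_UniformSpace) f t.
Proof.
  rewrite is_Rderive_pair, Ccontinuous_pair. intros [H1 H2].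
  split; apply (ex_derive_continuous (K := R_AbsRing) (V := R_NormedModule)); eexists; eassumption.
Qed.

Lemma is_Rderive_const (c : C) (t : R) : is_Rderive (fun _ => c) t (RtoC 0).
Proof. apply is_Rderive_pair. split; apply (is_derive_const (V := R_NormedModule)). Qed.

Lemma is_Rderive_unique (f : R -> C) (t : R) (l l' : C) :
  is_Rderive f t l -> is_Rderive f t l' -> l = l'.
Proof.
  rewrite !is_Rderive_pair. intros [A1 A2] [B1 B2].
  apply is_derive_unique in A1, A2, B1, B2.
  apply injective_projections; congruence.
Qed.

Lemma is_Rderive_ext_loc (f g : R -> C) (t : R) (l : C) :
  locally t (fun s => f s = g s) -> is_Rderive f t l -> is_Rderive g t l.
Proof. apply (is_derive_ext_loc (V := C_R_NormedModule)). Qed.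

Lemma is_Rderive_minus (f g : R -> C) (t : R) (df dg : C) :
  is_Rderive f t df -> is_Rderive g t dg -> is_Rderive (fun s => f s - g s)%C t (df - dg)%C.
Proof. exact (is_derive_minus (V := C_R_NormedModule) f g t df dg). Qed.

Lemma is_Rderive_scal (c : C) (g : R -> C) (t : R) (dg : C) :
  is_Rderive g t dg -> is_Rderive (fun s => c * g s)%C t (c * dg)%C.
Proof.
  intros H. replace (c * dg)%C with (0 * g t + c * dg)%C by ring.
  apply is_Rderive_mult; [apply is_Rderive_const | exact H].
Qed.

Lemma velocity_correct (g : R -> C) (t : R) :
  ex_derive (K := R_AbsRing) (V := C_R_NormedModule) g t -> is_Rderive g t (velocity g t).
Proof.
  intros [l H]. apply is_Rderive_pair in H as H'. destruct H' as [H1 H2].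
  replace (velocity g t) with l; [exact H|].
  apply is_derive_unique in H1, H2.
  unfold velocity. apply injective_projections; symmetry; [exact H1 | exact H2].
Qed.

(** Differentiability is asked on the open interval only: in [exp_primitive] the curve starts at 0,
    where the differential equation is not at hand and continuity takes over. *)
Lemma Rderive_zero_constant (u : R -> C) :
  (forall t, 0 < t < 1 -> is_Rderive u t (RtoC 0)) ->
  (forall t, 0 <= t <= 1 -> continuous (T := R_UniformSpace) (U := C_UniformSpace) u t) ->
  u 1 = u 0.
Proof.
  intros Hd Hc.
  assert (H : forall v : R -> R, (forall t, 0 < t < 1 -> is_derive v t 0) ->
    (forall t, 0 <= t <= 1 -> continuous v t) -> v 1 = v 0).
  { intros v Hdv Hcv.
    destruct (MVT_gen v 0 1 (fun _ => 0)) as [c [_ Hv]]; [| |lra];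
      rewrite Rmin_left, Rmax_right by lra.
    - exact Hdv.
    - intros t Ht. apply continuity_pt_filterlim. exact (Hcv t Ht). }
  apply injective_projections.
  - apply (H (fun t => fst (u t))); intros t Ht.
    + apply (is_Rderive_pair u t (RtoC 0)), Hd, Ht.
    + apply Ccontinuous_pair, Hc, Ht.
  - apply (H (fun t => snd (u t))); intros t Ht.
    + apply (is_Rderive_pair u t (RtoC 0)), Hd, Ht.
    + apply Ccontinuous_pair, Hc, Ht.
Qed.

(** On each C^1 piece [L] composed with the curve is a primitive, and the pieces add up by Chasles.
    The integrand [f] is separate from the continuous [h] because the two agree on the disc only. *)
Lemma line_integral_primitive (L h f : C -> C) (g : R -> C) (a b : C) :
  (forall z, in_disc z -> is_Cderive L z (h z)) ->
  (forall z, in_disc z -> continuous (T := C_UniformSpace) (U := C_UniformSpace) h z) ->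
  (forall z, in_disc z -> f z = h z) ->
  path_in_disc g a b -> is_line_integral f g (L b - L a)%C.
Proof.
  intros HL Hh Hf [[n [t [Ht0 [Htn Hpiece]]]] [Ha [Hb Hdisc]]].
  assert (Hmono : forall i j, (i <= j)%nat -> (j <= n)%nat -> t i <= t j).
  { intros i j Hij. induction Hij as [|j Hij IH]; intros Hj; [lra|].
    destruct (Hpiece j) as [Hlt _]; [lia|]. specialize (IH ltac:(lia)). lra. }
  assert (H : forall i, (i <= n)%nat ->
    is_RInt (V := C_R_NormedModule) (fun t => f (g t) * velocity g t)%C 0 (t i)
      (L (g (t i)) - L (g 0))%C).
  { induction i as [|i IH]; intros Hi.
    - rewrite Ht0. replace (L (g 0) - L (g 0))%C with (RtoC 0) by ring.
      apply (is_RInt_point (V := C_R_NormedModule)).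
    - specialize (IH ltac:(lia)). destruct (Hpiece i) as [Hlt [k [Hk Hgk]]]; [lia|].
      assert (H0i := Hmono O i ltac:(lia) ltac:(lia)).
      assert (H1i := Hmono (S i) n ltac:(lia) ltac:(lia)).
      replace (L (g (t (S i))) - L (g 0))%C
        with (L (g (t i)) - L (g 0) + (L (g (t (S i))) - L (g (t i))))%C by ring.
      apply (is_RInt_Chasles (V := C_R_NormedModule)) with (1 := IH).
      assert (Hkd : forall s, t i <= s <= t (S i) -> in_disc (k s)).
      { intros s Hs. rewrite <- Hgk by exact Hs. apply Hdisc. lra. }
      (* Only interior points of the piece are compared: there [g] and [k] agree in a neighbourhood
         and so have the same velocity. *)
      apply is_RInt_ext with (fun s => velocity k s * h (k s))%C.
      { rewrite Rmin_left, Rmax_right by lra. intros s Hs.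
        rewrite <- Hf by (apply Hkd; lra). rewrite (Hgk s) by lra.
        replace (velocity g s) with (velocity k s); [apply Cmult_comm|].
        assert (Hloc : locally s (fun y => k y = g y)).
        { apply (locally_interval _ s (Finite (t i)) (Finite (t (S i)))); [apply Hs | apply Hs|].
          intros y Hy1 Hy2. simpl in Hy1, Hy2. symmetry. apply Hgk. lra. }
        unfold velocity. f_equal; apply Derive_ext_loc;
          apply filter_imp with (2 := Hloc); intros y Hy; now rewrite Hy. }
      rewrite (Hgk (t i)), (Hgk (t (S i))) by lra.
      apply (is_RInt_Rderive (fun s => L (k s))); rewrite Rmin_left, Rmax_right by lra;
        intros s Hs; destruct (Hk s) as [Hk1 Hk2].
      + apply is_Rderive_comp; [apply HL, Hkd, Hs | now apply velocity_correct].
      + apply Ccontinuous_mult; [exact Hk2|].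
        apply (continuous_comp (U := R_UniformSpace) (V := C_UniformSpace) (W := C_UniformSpace) k h).
        * apply (is_Rderive_continuous k s _ (velocity_correct k s Hk1)).
        * apply Hh, Hkd, Hs. }
  specialize (H n (le_n n)). rewrite Htn, Hb, Ha in H. exact H.
Qed.

Lemma is_Cderive_continuous (f : C -> C) (z l : C) :
  is_Cderive f z l -> continuous (T := C_UniformSpace) (U := C_UniformSpace) f z.
Proof.
  rewrite is_Cderive_eps. intros H P HP.
  destruct (locally_norm_le_locally (V := C_NormedModule) _ P HP) as [eps Heps].
  destruct (H (mkposreal 1 Rlt_0_1)) as [d Hd]. simpl in Hd.
  assert (Hl := Cmod_ge_0 l).
  assert (Hm : 0 < Rmin d (eps / (Cmod l + 1))).
  { apply Rmin_pos; [apply cond_pos|]. apply Rdiv_lt_0_compat; [apply cond_pos | lra]. }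
  apply (locally_le_locally_norm (V := C_NormedModule)).
  exists (mkposreal _ Hm). intros y Hy. change (Cmod (y - z) < Rmin d (eps / (Cmod l + 1))) in Hy.
  change C in y.
  apply Heps. change (Cmod (f y - f z) < eps).
  specialize (Hd y (Rlt_le_trans _ _ _ Hy (Rmin_l _ _))).
  assert (H2 := Rlt_le_trans _ _ _ Hy (Rmin_r _ _)).
  apply (Rmult_lt_compat_l (Cmod l + 1)) in H2; [|lra].
  replace ((Cmod l + 1) * (eps / (Cmod l + 1))) with (pos eps) in H2 by (field; lra).
  replace (f y - f z)%C with ((f y - f z - (y - z) * l) + (y - z) * l)%C by ring.
  eapply Rle_lt_trans; [apply Cmod_triangle|]. rewrite Cmod_mult. lra.
Qed.

Lemma Cmod_Cexp (z : C) : Cmod (Cexp z) = exp (Re z).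
Proof.
  unfold Cmod, Cexp. simpl.
  replace (exp (Re z) * cos (Im z) * (exp (Re z) * cos (Im z) * 1)
    + exp (Re z) * sin (Im z) * (exp (Re z) * sin (Im z) * 1))
    with (Rsqr (exp (Re z)) * (Rsqr (sin (Im z)) + Rsqr (cos (Im z)))) by (unfold Rsqr; ring).
  rewrite sin2_cos2, Rmult_1_r. apply sqrt_Rsqr. left. apply exp_pos.
Qed.

Lemma Cexp_opp_mult (z : C) : (Cexp (- z) * Cexp z)%C = 1.
Proof.
  assert (E : exp (- Re z) * exp (Re z) = 1)
    by (rewrite <- exp_plus, Rplus_opp_l; apply exp_0).
  assert (S := sin2_cos2 (Im z)). unfold Rsqr in S.
  unfold Cexp, Cmult. simpl. fold (Re z) (Im z).
  rewrite cos_neg, sin_neg. apply injective_projections; simpl.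
  - replace 1 with (exp (- Re z) * exp (Re z) * (sin (Im z) * sin (Im z) + cos (Im z) * cos (Im z)))
      by (rewrite E, S; ring). ring.
  - ring.
Qed.

Lemma is_RInt_C_unique (f : R -> C) (a b : R) (l l' : C) :
  is_RInt (V := C_R_NormedModule) f a b l -> is_RInt (V := C_R_NormedModule) f a b l' -> l = l'.
Proof.
  intros H H'. apply injective_projections.
  - apply (is_RInt_fct_extend_fst (U := R_NormedModule) (V := R_NormedModule)) in H, H'.
    apply (is_RInt_unique (V := R_CompleteNormedModule)) in H, H'. exact (eq_trans (eq_sym H) H').
  - apply (is_RInt_fct_extend_snd (U := R_NormedModule) (V := R_NormedModule)) in H, H'.
    apply (is_RInt_unique (V := R_CompleteNormedModule)) in H, H'. exact (eq_trans (eq_sym H) H').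
Qed.

Lemma is_RInt_gen_C_unique (f : R -> C) (l l' : C) :
  is_RInt_gen (V := C_R_NormedModule) f (at_point 0) (Rbar_locally p_infty) l ->
  is_RInt_gen (V := C_R_NormedModule) f (at_point 0) (Rbar_locally p_infty) l' -> l = l'.
Proof.
  apply (filterlimi_locally_unique (V := C_R_NormedModule)).
  apply filter_forall. intros ab y1 y2. apply is_RInt_C_unique.
Qed.

(* [- M z / k] is the integral because [r |-> M (z * Cexp (r * k)) / k] is a
   primitive of the integrand that tends to [0] at infinity. *)
Lemma is_RInt_gen_decay (a : nat -> C) (rho : R) (Psi : C -> C) (z k : C) :
  has_series a rho Psi -> a O = 0 -> Cmod z < rho -> Re k < 0 ->
  is_RInt_gen (V := C_R_NormedModule) (fun r : R => Psi (z * Cexp (RtoC r * k))%C)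
    (at_point 0) (Rbar_locally p_infty) (- CPS (prim_coef (fun n => a (S n))) z / k)%C.
Proof.
  intros HPsi Ha0 Hz Hk.
  assert (Hk0 : k <> 0) by (intros ->; simpl in Hk; lra).
  set (M := CPS (prim_coef (fun n => a (S n)))).
  assert (HP := has_series_div_z a rho Psi HPsi Ha0).
  set (P := fun z : C => if Ceq_dec z 0 then a 1%nat else (Psi z / z)%C) in HP.
  assert (HwP : forall w, Cmod w < rho -> Psi w = (w * P w)%C).
  { intros w Hw. exact (has_series_unique _ _ _ _ _ HPsi (has_series_mul_z _ _ _ HP Ha0) Hw). }
  assert (HM : has_series (prim_coef (fun n => a (S n))) rho M) by exact (has_series_prim _ _ _ HP).
  assert (HM' : forall w, Cmod w < rho -> is_Cderive M w (P w)).
  { intros w Hw. apply (has_series_is_derive _ rho _ _ _ HM); [|exact Hw].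
    apply has_series_ext with (3 := HP); [|reflexivity].
    intros n. exact (eq_sym (deriv_prim_coef (fun n => a (S n)) n)). }
  assert (HRe : forall r, Re (RtoC r * k)%C = r * Re k) by (intros r; unfold Re; simpl; ring).
  set (gam r := (z * Cexp (RtoC r * k))%C).
  assert (Hgam_mod : forall r, Cmod (gam r) = Cmod z * exp (r * Re k)).
  { intros r. unfold gam. now rewrite Cmod_mult, Cmod_Cexp, HRe. }
  assert (Hz0 := Cmod_ge_0 z).
  assert (Hgam : forall r, 0 <= r -> Cmod (gam r) < rho).
  { intros r Hr. rewrite Hgam_mod.
    assert (exp (r * Re k) <= 1).
    { rewrite <- exp_0. destruct (Req_dec (r * Re k) 0) as [->|Hne]; [lra|].
      left. apply exp_increasing. nra. }
    assert (Hp := exp_pos (r * Re k)). nra. }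
  assert (Hgam' : forall r, is_Rderive gam r (gam r * k)%C).
  { intros r. unfold gam. rewrite <- Cmult_assoc.
    apply is_Rderive_scal. apply (is_Rderive_Cexp (fun r => RtoC r * k)%C), is_Rderive_linear. }
  assert (HI : forall T, 0 <= T ->
    is_RInt (V := C_R_NormedModule) (fun r => Psi (gam r)) 0 T (/ k * M (gam T) - / k * M (gam 0))%C).
  { intros T HT. apply (is_RInt_Rderive (fun r => / k * M (gam r))%C);
      rewrite Rmin_left, Rmax_right by lra; intros r Hr.
    (* The spiral satisfies gam' = k gam; the factor gam turns [P] back into [Psi], and [/ k]
       absorbs the rest. *)
    - replace (Psi (gam r)) with (/ k * ((gam r * k) * P (gam r)))%C.
      + apply is_Rderive_scal. apply is_Rderive_comp; [apply HM', Hgam; lra | apply Hgam'].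
      + rewrite HwP by (apply Hgam; lra). field. exact Hk0.
    - destruct (has_series_derive _ _ _ (gam r) HPsi (Hgam r (proj1 Hr))) as [l [_ Hl]].
      eapply is_Rderive_continuous, is_Rderive_comp; [exact Hl | apply Hgam']. }
  assert (Hrho : 0 < rho) by lra.
  assert (HM0 : M 0 = 0) by (rewrite (has_series_at_0 _ _ _ Hrho HM); reflexivity).
  intros Q HQ.
  destruct (locally_norm_le_locally (V := C_NormedModule) _ Q HQ) as [eps Heps].
  assert (Hc := HM' 0 ltac:(rewrite Cmod_0; lra)).
  apply is_Cderive_continuous in Hc.
  assert (Hkpos := proj1 (Cmod_gt_0 k) Hk0).
  assert (He : 0 < eps * Cmod k) by (apply Rmult_lt_0_compat; [apply cond_pos | exact Hkpos]).
  specialize (Hc (fun y => Cmod (y - M 0) < eps * Cmod k)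
    (locally_le_locally_norm (V := C_NormedModule) (M 0) _
      (ex_intro _ (mkposreal _ He) (fun y Hy => Hy)))).
  apply (locally_norm_le_locally (V := C_NormedModule)) in Hc. destruct Hc as [d Hd].
  (* Beyond [T0] the modulus [Cmod z * exp (T * Re k)] is below [d]; the inequality turns because
     [Re k < 0], and [Cmod z + 1] covers the case z = 0. *)
  set (T0 := Rmax 0 (ln (d / (Cmod z + 1)) / Re k)).
  exists (fun x => x = 0) (fun T => T0 < T).
  { reflexivity. }
  { exists T0. auto. }
  intros x T -> HT. simpl.
  assert (HT0 : 0 < T) by (eapply Rle_lt_trans; [apply Rmax_l | exact HT]).
  exists (/ k * M (gam T) - / k * M (gam 0))%C. split; [apply HI; lra|].
  apply Heps. change (Cmod (/ k * M (gam T) - / k * M (gam 0) - (- M z / k)) < eps).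
  assert (Hg0 : gam 0 = z).
  { unfold gam. replace (RtoC 0 * k)%C with (RtoC 0) by ring.
    unfold Cexp. simpl. rewrite exp_0, cos_0, sin_0.
    apply injective_projections; simpl; ring. }
  rewrite Hg0.
  replace (/ k * M (gam T) - / k * M z - (- M z / k))%C with (M (gam T) / k)%C by (field; exact Hk0).
  rewrite Cmod_div by exact Hk0.
  apply (Rlt_div_l _ eps _ Hkpos).
  assert (Hsmall : Cmod (gam T - 0) < d).
  { replace (gam T - 0)%C with (gam T) by ring. rewrite Hgam_mod.
    assert (HTk : T * Re k < ln (d / (Cmod z + 1))).
    { assert (H1 : ln (d / (Cmod z + 1)) / Re k < T)
        by (eapply Rle_lt_trans; [apply Rmax_r | exact HT]).
      apply (Rmult_lt_gt_compat_neg_l (Re k)) in H1; [|exact Hk].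
      replace (Re k * (ln (d / (Cmod z + 1)) / Re k)) with (ln (d / (Cmod z + 1))) in H1
        by (field; lra). lra. }
    apply exp_increasing in HTk.
    assert (Hdz : 0 < d / (Cmod z + 1)) by (apply Rdiv_lt_0_compat; [apply cond_pos | lra]).
    rewrite exp_ln in HTk by exact Hdz.
    apply (Rmult_lt_compat_l (Cmod z + 1)) in HTk; [|lra].
    replace ((Cmod z + 1) * (d / (Cmod z + 1))) with (pos d) in HTk by (field; lra).
    assert (Hp := exp_pos (T * Re k)). lra. }
  specialize (Hd _ Hsmall). cbv beta in Hd. rewrite HM0 in Hd.
  now replace (M (gam T) - 0)%C with (M (gam T)) in Hd by ring.
Qed.

(** * Coefficient recursions *)

(** The approximation [X m] is already correct at every index below [m], because [F n] looks only
    below [n]; the diagonal is then a fixed point. *)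
Lemma strong_recursion (F : nat -> (nat -> R) -> R) :
  (forall n x y, (forall k, (k < n)%nat -> x k = y k) -> F n x = F n y) ->
  exists x : nat -> R, forall n, x n = F n x.
Proof.
  intros HF.
  set (X := fix X (m : nat) : nat -> R :=
    match m with O => fun _ => 0 | S m' => fun n => F n (X m') end).
  assert (H : forall n m, (n < m)%nat -> X m n = X (S n) n).
  { induction n as [n IH] using (well_founded_induction Wf_nat.lt_wf). intros m Hm.
    destruct m as [|m]; [lia|]. apply HF. intros k Hk.
    change (X m k = X n k). rewrite (IH k Hk m), (IH k Hk n) by lia. reflexivity. }
  exists (fun n => X (S n) n). intros n. apply HF. intros k Hk. now apply H.
Qed.

Definition Rconv (a b : nat -> R) (n : nat) : R := sum_n (fun k => a k * b (n - k)%nat) n.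

Lemma conv_RtoC (a b : nat -> R) (n : nat) :
  conv (fun k => RtoC (a k)) (fun k => RtoC (b k)) n = RtoC (Rconv a b n).
Proof.
  unfold conv, Rconv. generalize n at 2 4 as m. intros m.
  induction m as [|m IH]; [rewrite !sum_O; now rewrite RtoC_mult|].
  rewrite !sum_Sn, IH, <- RtoC_mult. symmetry. apply RtoC_plus.
Qed.

(** With [c 0 = 0] the term of [Rconv c x n] containing [x n] vanishes, so the right-hand side uses
    earlier values only. The solution and the integrand are both obtained from this form. *)
Lemma linear_recursion (c b s : nat -> R) :
  c O = 0 -> exists x : nat -> R, forall n, x n = b n + s n * Rconv c x n.
Proof.
  intros Hc. apply strong_recursion. intros n x y Hxy. do 2 f_equal.
  apply sum_n_ext_loc. intros [|k] Hk; [now rewrite Hc, !Rmult_0_l|].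
  rewrite Hxy by lia. reflexivity.
Qed.

Lemma Rconv_bound (c x : nat -> R) (B : R) (n : nat) :
  c O = 0 -> (forall k, 0 <= c k) -> (forall k, (k < n)%nat -> 0 <= x k <= B) ->
  0 <= Rconv c x n <= B * sum_n c n.
Proof.
  intros Hc0 Hc Hx. rewrite <- Rsum_n_scal. split.
  - eapply Rle_trans; [|apply (Rsum_n_le (fun _ => 0))].
    + rewrite sum_n_const. lra.
    + intros [|k] Hk; [rewrite Hc0; lra|].
      apply Rmult_le_pos; [apply Hc | apply Hx; lia].
  - apply Rsum_n_le. intros [|k] Hk; [rewrite Hc0; lra|].
    rewrite Rmult_comm. apply Rmult_le_compat_r; [apply Hc | apply Hx; lia].
Qed.

Lemma sum_n_le_series (c : nat -> R) (s : R) (n : nat) :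
  (forall k, 0 <= c k) -> is_series c s -> sum_n c n <= s.
Proof.
  intros Hc Hs. apply (is_lim_seq_incr_compare (sum_n c)); [exact Hs|].
  intros m. rewrite sum_Sn. specialize (Hc (S m)). unfold plus; simpl. lra.
Qed.

(** For n at least 2 the equation solves to a_n = n / ((n - 1) q1) times the convolution. By
    induction the earlier coefficients are at most n - 1 and the [c k] sum to at most [q1], so the
    convolution is at most (n - 1) q1 and a_n at most n. *)
Lemma solution_coef (c : nat -> R) (q1 : R) :
  c O = 0 -> (forall k, 0 <= c k) -> is_series c q1 -> 0 < q1 ->
  exists a : nat -> R, a O = 0 /\ a 1%nat = 1 /\ (forall n, 0 <= a n <= INR n) /\
    forall n, q1 * a (S n) - Rconv c a (S n) = q1 * (a (S n) / INR (S n)).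
Proof.
  intros Hc0 Hc Hs Hq.
  destruct (linear_recursion c (fun n => if PeanoNat.Nat.eq_dec n 1 then 1 else 0)
    (fun n => INR n / ((INR n - 1) * q1)) Hc0) as [a Ha].
  assert (Ha0 : a O = 0).
  { rewrite Ha. simpl. unfold Rconv. rewrite sum_O, Hc0. lra. }
  (* At n = 1 the multiplier is a division by zero; the vanishing convolution leaves the prescribed
     value 1. *)
  assert (Hr1 : Rconv c a 1 = 0).
  { unfold Rconv. rewrite sum_Sn, sum_O, Hc0. simpl. rewrite Ha0. unfold plus; simpl. lra. }
  assert (Ha1 : a 1%nat = 1) by (rewrite Ha, Hr1; simpl; lra).
  assert (HaS : forall n, a (S (S n)) =
    INR (S (S n)) / (INR (S n) * q1) * Rconv c a (S (S n))).
  { intros n. rewrite Ha at 1. rewrite (S_INR (S n)) at 2.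
    destruct (PeanoNat.Nat.eq_dec (S (S n)) 1) as [E|_]; [lia|].
    replace (INR (S n) + 1 - 1) with (INR (S n)) by ring. ring. }
  assert (HS : forall n, 0 < INR (S n)) by (intros n; apply lt_0_INR; lia).
  exists a. split; [exact Ha0|]. split; [exact Ha1|]. split.
  - induction n as [n IH] using (well_founded_induction Wf_nat.lt_wf).
    destruct n as [|[|n]]; [rewrite Ha0; simpl; lra | rewrite Ha1; simpl; lra|].
    destruct (Rconv_bound c a (INR (S n)) (S (S n)) Hc0 Hc) as [B1 B2].
    { intros k Hk. destruct (IH k Hk) as [H1 H2]. split; [exact H1|].
      eapply Rle_trans; [exact H2|]. apply le_INR. lia. }
    assert (Hs' := sum_n_le_series c q1 (S (S n)) Hc Hs).
    assert (H1 := HS n). assert (H2 := HS (S n)).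
    assert (Hp : 0 < INR (S n) * q1) by now apply Rmult_lt_0_compat.
    rewrite HaS. split.
    + apply Rmult_le_pos; [|exact B1]. left. now apply Rdiv_lt_0_compat.
    + apply Rle_trans with (INR (S (S n)) / (INR (S n) * q1) * (INR (S n) * q1)).
      * apply Rmult_le_compat_l; [left; now apply Rdiv_lt_0_compat|]. nra.
      * right. field. lra.
  - intros [|n]; [rewrite Hr1, Ha1; simpl; field|].
    assert (H1 := HS n). assert (H2 := HS (S n)).
    rewrite HaS. rewrite (S_INR (S n)) in *. field. lra.
Qed.

(** The coefficient of z^(n+1) in z q' + q is (n + 2) c_(n+1), and dividing by z moves it to index
    n. If the earlier h_k are at most n + 2, then q1 h_n is at most n + 2 times the sum of [c] up to
    n + 1, hence at most (n + 2) q1. *)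
Lemma integrand_coef (c : nat -> R) (q1 : R) :
  c O = 0 -> (forall k, 0 <= c k) -> is_series c q1 -> 0 < q1 ->
  exists h : nat -> R, (forall n, 0 <= h n <= INR n + 2) /\
    forall n, q1 * h n - Rconv c h n = (INR n + 2) * c (S n).
Proof.
  intros Hc0 Hc Hs Hq.
  destruct (linear_recursion c (fun n => (INR n + 2) * c (S n) / q1) (fun _ => / q1) Hc0) as [h Hh].
  exists h. split.
  - induction n as [n IH] using (well_founded_induction Wf_nat.lt_wf).
    assert (Hn := pos_INR n).
    destruct (Rconv_bound c h (INR n + 2) n Hc0 Hc) as [B1 B2].
    { intros k Hk. destruct (IH k Hk) as [H1 H2]. split; [exact H1|].
      eapply Rle_trans; [exact H2|]. apply Rplus_le_compat_r, le_INR. lia. }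
    assert (Hs' := sum_n_le_series c q1 (S n) Hc Hs). rewrite sum_Sn in Hs'.
    change (sum_n c n + c (S n) <= q1) in Hs'.
    assert (Hc' := Hc (S n)).
    replace (h n) with (((INR n + 2) * c (S n) + Rconv c h n) / q1) by (rewrite (Hh n); field; lra).
    split.
    + apply Rmult_le_pos; [|left; now apply Rinv_0_lt_compat].
      apply Rplus_le_le_0_compat; [apply Rmult_le_pos; lra | exact B1].
    + apply Rle_div_l; [exact Hq|]. nra.
  - intros n. rewrite (Hh n) at 1. field. lra.
Qed.

(** The square of the geometric series has the terms (n + 1) s^n; one more geometric series gives n
    + 2. *)
Lemma ex_series_linear_growth (a : nat -> C) (s : R) :
  (forall n, Cmod (a n) <= INR n + 2) -> 0 <= s < 1 -> ex_series (fun n => Cmod (a n) * s ^ n).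
Proof.
  intros Ha Hs.
  apply ex_series_le_pos with (b := fun n => (INR n + 2) * s ^ n).
  - intros n. assert (0 <= s ^ n) by (apply pow_le; lra). split.
    + apply Rmult_le_pos; [apply Cmod_ge_0 | assumption].
    + apply Rmult_le_compat_r; auto.
  - assert (Hg : is_series (fun n => s ^ n) (/ (1 - s)))
      by (apply is_series_geom; rewrite Rabs_pos_eq; lra).
    assert (Hnn : forall n, 0 <= s ^ n) by (intros n; apply pow_le; lra).
    assert (Hgg := is_series_mult_pos _ _ _ _ Hg Hg Hnn Hnn).
    eexists. eapply is_series_ext; [|exact (is_series_plus _ _ _ _ Hgg Hg)].
    intros n. simpl.
    replace (sum_f_R0 (fun k => s ^ k * s ^ (n - k)) n) with ((INR n + 1) * s ^ n).
    + unfold plus; simpl. ring.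
    + rewrite <- sum_n_Reals, (sum_n_ext_loc _ (fun _ => s ^ n)).
      * now rewrite sum_n_const, S_INR.
      * intros k Hk. rewrite <- pow_add. f_equal. lia.
Qed.

(** * Identity theorem *)

(** On the segment from 0 to [z], let [m] be the supremum of the parameters up to which [F] and [G]
    agree. Points of agreement accumulate at [m * z], so the expansions there coincide and agreement
    passes beyond [m] unless [m] is 1. *)
Lemma identity_theorem (F G : C -> C) (r : R) :
  analytic_in_disc F -> analytic_in_disc G -> 0 < r ->
  (forall z, Cmod z < r -> F z = G z) ->
  forall z, in_disc z -> F z = G z.
Proof.
  intros HF HG Hr HFG z Hz. unfold in_disc in Hz.
  destruct (Ceq_dec z 0) as [->|Hz0]; [apply HFG; rewrite Cmod_0; exact Hr|].
  assert (Hzp := proj1 (Cmod_gt_0 z) Hz0).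
  assert (Hmod : forall t, Cmod (RtoC t * z) = Rabs t * Cmod z)
    by (intros t; now rewrite Cmod_mult, Cmod_R).
  set (E t := 0 <= t <= 1 /\ forall s, 0 <= s <= t -> F (RtoC s * z)%C = G (RtoC s * z)%C).
  assert (HE0 : forall t, 0 <= t <= 1 -> t * Cmod z < r -> E t).
  { intros t Ht Htr. split; [exact Ht|]. intros s Hs. apply HFG.
    rewrite Hmod, Rabs_pos_eq by lra. nra. }
  destruct (completeness E) as [m [Hub Hlub]].
  { exists 1. intros t [Ht _]. lra. }
  { exists 0. apply HE0; lra. }
  assert (Hm1 : m <= 1) by (apply Hlub; intros t [Ht _]; lra).
  assert (Hm0 : 0 < m).
  { apply Rlt_le_trans with (Rmin 1 (r / (2 * Cmod z))).
    - apply Rmin_pos; [lra|]. apply Rdiv_lt_0_compat; lra.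
    - apply Hub, HE0.
      + split; [|apply Rmin_l]. apply Rmin_glb; [lra|]. left. apply Rdiv_lt_0_compat; lra.
      + apply Rle_lt_trans with (r / (2 * Cmod z) * Cmod z).
        * apply Rmult_le_compat_r; [lra | apply Rmin_r].
        * replace (r / (2 * Cmod z) * Cmod z) with (r / 2) by (field; lra). lra. }
  assert (Hbelow : forall s, 0 <= s < m -> F (RtoC s * z)%C = G (RtoC s * z)%C).
  { intros s Hs. destruct (Classical_Prop.classic (exists t, E t /\ s < t)) as [[t [[_ Ht] Hst]]|Hno].
    - apply Ht. lra.
    - exfalso. assert (m <= s); [|lra]. apply Hlub. intros t Ht.
      apply Rnot_lt_le. intros Hst. apply Hno. now exists t. }
  assert (Hdm : in_disc (RtoC m * z)).
  { unfold in_disc. rewrite Hmod, Rabs_pos_eq by lra. nra. }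
  destruct (analytic_at_has_series _ _ (HF _ Hdm)) as [a [r1 [Hr1 Ha]]].
  destruct (analytic_at_has_series _ _ (HG _ Hdm)) as [b [r2 [Hr2 Hb]]].
  assert (Hr3 : 0 < Rmin r1 r2) by now apply Rmin_pos.
  apply (has_series_le _ (Rmin r1 r2)) in Ha; [|apply Rmin_l].
  apply (has_series_le _ (Rmin r1 r2)) in Hb; [|apply Rmin_r].
  assert (HD := has_series_minus _ _ _ _ _ Ha Hb).
  assert (Hab : forall k, (a k - b k)%C = 0).
  { intros k. apply (has_series_zeros k _ _ _ Hr3 HD). intros eps He.
    (* A step back from [m] that stays on the segment and has length below [eps]. *)
    set (u := Rmin m (eps / (2 * Cmod z))).
    assert (Hu : 0 < u) by (apply Rmin_pos; [lra | apply Rdiv_lt_0_compat; lra]).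
    assert (Hu1 : u <= m) by apply Rmin_l.
    assert (Hu2 : u * Cmod z <= eps / 2).
    { replace (eps / 2) with (eps / (2 * Cmod z) * Cmod z) by (field; lra).
      apply Rmult_le_compat_r; [lra | apply Rmin_r]. }
    exists (RtoC (- u) * z)%C. repeat split.
    - apply Cmult_neq_0; [|exact Hz0]. intros Eu. apply (f_equal fst) in Eu. simpl in Eu. lra.
    - rewrite Hmod, Rabs_Ropp, Rabs_pos_eq by lra. lra.
    - replace (RtoC m * z + RtoC (- u) * z)%C with (RtoC (m - u) * z)%C
        by (unfold Rminus; rewrite RtoC_plus; ring).
      rewrite Hbelow by lra. ring. }
  assert (Hnear : forall w, Cmod w < Rmin r1 r2 -> F (RtoC m * z + w)%C = G (RtoC m * z + w)%C).
  { intros w Hw. apply (is_Cseries_unique (fun n => a n * w ^ n)%C); [exact (Ha w Hw)|].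
    apply is_Cseries_ext with (2 := Hb w Hw). intros n.
    replace (a n) with (a n - b n + b n)%C by ring. rewrite Hab. ring. }
  assert (Hext : forall s, Rabs (s - m) * Cmod z < Rmin r1 r2 -> F (RtoC s * z)%C = G (RtoC s * z)%C).
  { intros s Hs. replace (RtoC s * z)%C with (RtoC m * z + RtoC (s - m) * z)%C
      by (unfold Rminus; rewrite RtoC_plus, RtoC_opp; ring).
    apply Hnear. now rewrite Hmod. }
  (* Past [m] by half of what the common radius allows, capped at 1. Since [u <= m], the cap must be
     the active term. *)
  set (u := Rmin 1 (m + Rmin r1 r2 / (2 * Cmod z))).
  assert (Hd : 0 < Rmin r1 r2 / (2 * Cmod z)) by (apply Rdiv_lt_0_compat; lra).
  assert (HEu : E u).
  { split.
    - split; [apply Rmin_glb; lra | apply Rmin_l].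
    - intros s Hs. destruct (Rlt_le_dec s m) as [Hsm|Hsm]; [apply Hbelow; lra|].
      apply Hext. rewrite Rabs_pos_eq by lra.
      apply Rle_lt_trans with (Rmin r1 r2 / (2 * Cmod z) * Cmod z).
      + apply Rmult_le_compat_r; [lra|].
        assert (u <= m + Rmin r1 r2 / (2 * Cmod z)) by apply Rmin_r. lra.
      + replace (Rmin r1 r2 / (2 * Cmod z) * Cmod z) with (Rmin r1 r2 / 2) by (field; lra). lra. }
  assert (Hu : u <= m) by now apply Hub.
  assert (Hu1 : u = 1).
  { unfold u in *. destruct (Rle_dec 1 (m + Rmin r1 r2 / (2 * Cmod z))).
    - now apply Rmin_left.
    - rewrite Rmin_right in Hu |- *; lra. }
  replace z with (RtoC 1 * z)%C by ring. apply HEu. rewrite Hu1. lra.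
Qed.

(** * The integral equation *)

(** As [c 0 = 0], every term contains a factor z, so the modulus is at most [q1 * Cmod z]; this
    makes the inequality strict. *)
Lemma Cmod_series_lt_total (c : nat -> R) (q1 : R) (z l : C) :
  c O = 0 -> (forall n, 0 <= c n) -> is_series c q1 -> 0 < q1 ->
  in_disc z -> is_Cpseries (fun n => RtoC (c n)) z l -> Cmod l < q1.
Proof.
  intros Hc0 Hc Hs Hq Hz Hl. unfold in_disc in Hz. assert (Hz0 := Cmod_ge_0 z).
  apply Rle_lt_trans with (q1 * Cmod z); [|nra].
  apply (Cmod_series_le _ (fun n => c n * Cmod z) _ _) with (2 := Hl).
  - intros [|n].
    + rewrite Hc0, Cmod_mult, Cmod_0. lra.
    + rewrite Cmod_mult, Cmod_pow, Cmod_R, Rabs_pos_eq by apply Hc.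
      apply Rmult_le_compat_l; [apply Hc|].
      assert (Hp : Cmod z ^ n <= 1) by (rewrite <- (pow1 n); apply pow_incr; lra).
      simpl. nra.
  - now apply is_series_scal_r.
Qed.

(** For n at least 2 the difference is multiplied by q1 (n - 1) / n, which is nonzero. At n = 1 this
    factor is 0, so that coefficient must be prescribed: hence the normalisation of the derivative
    at 0. *)
Lemma solution_coef_unique (c : nat -> C) (q1 : R) (a b : nat -> C) :
  c O = 0 -> q1 <> 0 -> a O = b O -> a 1%nat = b 1%nat ->
  (forall n, (RtoC q1 * a (S n) - conv c a (S n) = RtoC q1 * (a (S n) / RtoC (INR (S n))))%C) ->
  (forall n, (RtoC q1 * b (S n) - conv c b (S n) = RtoC q1 * (b (S n) / RtoC (INR (S n))))%C) ->
  forall n, a n = b n.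
Proof.
  intros Hc Hq H0 H1 Ha Hb n.
  induction n as [n IH] using (well_founded_induction Wf_nat.lt_wf).
  destruct n as [|[|n]]; [exact H0 | exact H1|].
  assert (Hconv : conv c a (S (S n)) = conv c b (S (S n))).
  { apply sum_n_ext_loc. intros [|k] Hk; [rewrite Hc; Cring|].
    now rewrite IH by lia. }
  assert (Hq' : RtoC q1 <> 0) by (intros E; apply Hq; now injection E).
  specialize (Ha (S n)). specialize (Hb (S n)). rewrite Hconv in Ha.
  assert (HnS := RtoC_INR_S_neq_0 n). assert (HnSS := RtoC_INR_S_neq_0 (S n)).
  assert (E : (RtoC q1 * RtoC (INR (S n)) / RtoC (INR (S (S n))) * (a (S (S n)) - b (S (S n))) = 0)%C).
  { replace (RtoC (INR (S n))) with (RtoC (INR (S (S n))) - 1)%C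
      by (rewrite (S_INR (S n)), RtoC_plus; ring).
    transitivity ((RtoC q1 * a (S (S n)) - conv c b (S (S n)) - RtoC q1 * (a (S (S n)) / RtoC (INR (S (S n)))))
      - (RtoC q1 * b (S (S n)) - conv c b (S (S n)) - RtoC q1 * (b (S (S n)) / RtoC (INR (S (S n))))))%C.
    - field. exact HnSS.
    - rewrite Ha, Hb. ring. }
  replace (a (S (S n))) with
    (b (S (S n)) + RtoC (INR (S (S n))) / (RtoC q1 * RtoC (INR (S n))) *
      (RtoC q1 * RtoC (INR (S n)) / RtoC (INR (S (S n))) * (a (S (S n)) - b (S (S n)))))%C
    by (field; auto).
  rewrite E. ring.
Qed.

Lemma has_series_C_derive (a : nat -> C) (rho : R) (F : C -> C) :
  has_series a rho F -> has_series (deriv_coef a) rho (C_derive F).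
Proof.
  intros H z Hz. destruct (has_series_derive a rho F z H Hz) as [l [Hl Hd]].
  now rewrite (is_C_derive_unique _ _ _ Hd).
Qed.

Lemma has_series_C_derive_correct (a : nat -> C) (rho : R) (F : C -> C) (z : C) :
  has_series a rho F -> Cmod z < rho -> is_Cderive F z (C_derive F z).
Proof.
  intros H Hz. exact (has_series_is_derive _ _ _ _ _ H (has_series_C_derive _ _ _ H) Hz).
Qed.

Lemma has_series_scal_minus_mult (k : C) (c a : nat -> C) (rho : R) (q F : C -> C) :
  has_series c rho q -> has_series a rho F ->
  has_series (fun n => k * a n - conv c a n)%C rho (fun z => (k - q z) * F z)%C.
Proof.
  intros Hq HF.
  apply has_series_ext with (3 := has_series_minus _ _ _ _ _
    (has_series_scal k _ _ _ HF) (has_series_mult _ _ _ _ _ Hq HF)); [reflexivity|].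
  intros z _. ring.
Qed.

Lemma has_series_unit_prim (a : nat -> C) (rho : R) (Psi : C -> C) :
  has_series a rho Psi -> a O = 0 ->
  has_series (prim_coef (fun n => a (S n))) rho (CPS (prim_coef (fun n => a (S n)))).
Proof. intros H H0. exact (has_series_prim _ _ _ (has_series_div_z _ _ _ H H0)). Qed.

(** The integral equation after evaluation along the spiral, cleared of denominators. One direction
    gives existence on the unit disc, the other uniqueness on a disc of unknown radius. *)
Lemma equation_coef_iff (c a : nat -> C) (q1 : R) (rho : R) (q Psi : C -> C) :
  0 < rho -> c O = 0 -> a O = 0 -> has_series c rho q -> has_series a rho Psi ->
  ((forall n, (RtoC q1 * a (S n) - conv c a (S n) = RtoC q1 * (a (S n) / RtoC (INR (S n))))%C) <->
   (forall z, Cmod z < rho ->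
     ((RtoC q1 - q z) * Psi z = RtoC q1 * CPS (prim_coef (fun n => a (S n))) z)%C)).
Proof.
  intros Hr Hc0 Ha0 Hq HPsi.
  assert (H1 := has_series_scal_minus_mult (RtoC q1) _ _ _ _ _ Hq HPsi).
  assert (H2 := has_series_scal (RtoC q1) _ _ _ (has_series_unit_prim _ _ _ HPsi Ha0)).
  split; intros H.
  - intros z Hz. apply (has_series_unique _ rho _
      (fun z => RtoC q1 * CPS (prim_coef (fun n => a (S n))) z)%C z H1); [|exact Hz].
    apply has_series_ext with (3 := H2); [|reflexivity].
    intros [|n]; [|symmetry; apply H].
    unfold conv. rewrite sum_O, Hc0, Ha0. simpl. Cring.
  - intros n. apply (has_series_coef_unique _ (fun n => RtoC q1 * prim_coef (fun n => a (S n)) n)%C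
      rho (fun z => (RtoC q1 - q z) * Psi z)%C (S n) Hr H1).
    apply has_series_ext with (3 := H2); [reflexivity|].
    intros z Hz. symmetry. now apply H.
Qed.

(** * The integrand and the exponential formula *)

Lemma integrand_equation (c h : nat -> C) (q1 : R) (q H : C -> C) (z : C) :
  has_series c 1 q -> has_series h 1 H -> c O = 0 ->
  (forall n, (RtoC q1 * h n - conv c h n = (RtoC (INR n) + 2) * c (S n))%C) ->
  in_disc z ->
  (z * ((RtoC q1 - q z) * H z) = C_derive q z * z + q z)%C.
Proof.
  intros Hq HH Hc0 Hh Hz.
  assert (H1 := has_series_scal_minus_mult (RtoC q1) _ _ _ _ _ Hq HH).
  set (e n := (RtoC (INR n) * c n)%C).
  assert (He : has_series e 1 (fun z => z * C_derive q z)%C).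
  { apply has_series_mul_z; [|unfold e; rewrite Hc0; ring].
    exact (has_series_C_derive _ _ _ Hq). }
  set (f n := (e n + c n)%C).
  assert (Hf : has_series f 1 (fun z => z * ((RtoC q1 - q z) * H z))%C).
  { apply has_series_mul_z; [|unfold f, e; rewrite Hc0; ring].
    apply has_series_ext with (3 := H1); [|reflexivity].
    intros n. rewrite Hh. unfold f, e. rewrite S_INR, RtoC_plus. ring. }
  assert (Hd := has_series_minus _ _ _ _ _ Hf Hq).
  assert (E : (z * ((RtoC q1 - q z) * H z) - q z = z * C_derive q z)%C).
  { apply (has_series_unique _ 1 _ (fun z => z * C_derive q z)%C z Hd); [|exact Hz].
    apply has_series_ext with (3 := He); [|reflexivity].
    intros n. unfold f. ring. }
  replace (C_derive q z * z)%C with (z * ((RtoC q1 - q z) * H z) - q z)%C by (rewrite E; ring).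
  ring.
Qed.

(** Off 0 the relation can be divided by the nonzero factor. At 0 the filled value is a limit over
    punctured neighbourhoods, where the quotient is [H], so continuity of [H] determines it. *)
Lemma integrand_eq (q H : C -> C) (q1 : R) :
  (forall z, in_disc z -> q z <> RtoC q1) ->
  (forall z, in_disc z -> (z * ((RtoC q1 - q z) * H z) = C_derive q z * z + q z)%C) ->
  continuous (T := C_UniformSpace) (U := C_UniformSpace) H (RtoC 0) ->
  forall z, in_disc z -> integrand q q1 z = H z.
Proof.
  intros Hq Heq Hc z Hz.
  assert (Hne : forall w, in_disc w -> w <> 0 ->
    ((C_derive q w * w + q w) / ((RtoC q1 - q w) * w))%C = H w).
  { intros w Hw Hw0. rewrite <- Heq by exact Hw. field. split; [exact Hw0|].
    intros E. apply (Hq w Hw). replace (q w) with (RtoC q1 - (RtoC q1 - q w))%C by ring.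
    rewrite E. ring. }
  unfold integrand, fill_singularity. destruct (Ceq_dec z 0) as [->|Hz0].
  - apply is_C_lim_unique. intros Q HQ. specialize (Hc Q HQ).
    assert (Hdisc : locally (T := C_UniformSpace) (RtoC 0) in_disc).
    { apply (locally_le_locally_norm (V := C_NormedModule)). exists (mkposreal 1 Rlt_0_1).
      intros y Hy. change C in y. change (Cmod (y - 0) < 1) in Hy.
      unfold in_disc. now replace (y - 0)%C with y in Hy by ring. }
    change (locally (T := C_UniformSpace) (RtoC 0) (fun y => Q (H y))) in Hc.
    unfold filtermap, locally', within.
    generalize (filter_and _ _ Hc Hdisc). apply filter_imp.
    intros y [HQy Hy] Hy0. rewrite Hne by assumption. exact HQy.
  - now apply Hne.
Qed.

(** Differentiating (q1 - q) z P = q1 M and using M' = P gives (q1 - q) z P' = (z q' + q) P, that is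
    P' = P H away from 0. The differentiation runs along the ray [t * w] at t = 1, where the product
    rule for curves applies. *)
Lemma log_derivative (q M P H : C -> C) (q1 : R) (w l : C) :
  in_disc w -> w <> 0 -> q w <> RtoC q1 ->
  is_Cderive q w (C_derive q w) -> is_Cderive M w (P w) -> is_Cderive P w l ->
  (forall z, in_disc z -> ((RtoC q1 - q z) * (z * P z) = RtoC q1 * M z)%C) ->
  (w * ((RtoC q1 - q w) * H w) = C_derive q w * w + q w)%C ->
  l = (P w * H w)%C.
Proof.
  intros Hw Hw0 Hqw Hq HM HP Heq HH.
  assert (E1 : (RtoC 1 * w)%C = w) by ring.
  assert (Hwp := proj1 (Cmod_gt_0 w) Hw0). unfold in_disc in Hw.
  assert (Hline := is_Rderive_linear w 1).
  assert (Hcomp : forall F d, is_Cderive F w d -> is_Rderive (fun t => F (RtoC t * w)%C) 1 (w * d)%C).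
  { intros F d HF. apply is_Rderive_comp; [rewrite E1; exact HF | exact Hline]. }
  assert (Hl := is_Rderive_mult _ _ _ _ _
    (is_Rderive_minus _ _ _ _ _ (is_Rderive_const (RtoC q1) 1) (Hcomp _ _ Hq))
    (is_Rderive_mult _ _ _ _ _ Hline (Hcomp _ _ HP))).
  assert (Hr := is_Rderive_scal (RtoC q1) _ _ _ (Hcomp _ _ HM)).
  assert (Hloc : locally 1 (fun t =>
    (RtoC q1 - q (RtoC t * w)) * (RtoC t * w * P (RtoC t * w)) = RtoC q1 * M (RtoC t * w))%C).
  { apply (locally_interval _ 1 (Finite 0) (Finite (/ Cmod w))); simpl; [lra | |].
    - rewrite <- Rinv_1. apply Rinv_lt_contravar; lra.
    - intros t Ht1 Ht2. apply Heq. unfold in_disc.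
      rewrite Cmod_mult, Cmod_R, Rabs_pos_eq by lra.
      apply (Rmult_lt_compat_r (Cmod w)) in Ht2; [|exact Hwp].
      rewrite Rinv_l in Ht2 by lra. exact Ht2. }
  assert (Hl' := is_Rderive_ext_loc _ _ _ _ Hloc Hl).
  assert (E := is_Rderive_unique _ _ _ _ Hl' Hr). cbv beta in E. rewrite !E1 in E.
  assert (Hq' : (RtoC q1 - q w)%C <> 0).
  { intros E0. apply Hqw. replace (q w) with (RtoC q1 - (RtoC q1 - q w))%C by ring.
    rewrite E0. ring. }
  set (k := (RtoC q1 - q w)%C) in *.
  assert (Eq1 : RtoC q1 = (k + q w)%C) by (unfold k; ring). rewrite Eq1 in E.
  assert (Z : (w * (w * k) * (l - P w * H w) = 0)%C).
  { transitivity (((0 - w * C_derive q w) * (w * P w) + k * (w * P w + w * (w * l)))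
      - (k + q w) * (w * P w) + w * P w * ((C_derive q w * w + q w) - w * (k * H w)))%C; [ring|].
    rewrite E, HH. ring. }
  replace l with (P w * H w + / (w * (w * k)) * (w * (w * k) * (l - P w * H w)))%C
    by (field; auto).
  rewrite Z. ring.
Qed.

(** Along the segment from 0 to [z], P times exp(L(0) - L) has derivative zero, so its values at the
    two ends agree. *)
Lemma exp_primitive (P L H : C -> C) (z : C) :
  in_disc z ->
  (forall w, in_disc w -> is_Cderive L w (H w)) ->
  (forall w, in_disc w -> w <> 0 -> is_Cderive P w (P w * H w)%C) ->
  (forall w, in_disc w -> continuous (T := C_UniformSpace) (U := C_UniformSpace) P w) ->
  P z = (P 0 * Cexp (L z - L 0))%C.
Proof.
  intros Hz HL HP HPc. unfold in_disc in Hz. assert (Hz0 := Cmod_ge_0 z).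
  destruct (Ceq_dec z 0) as [->|Hne].
  { replace (L 0 - L 0)%C with (RtoC 0) by ring.
    unfold Cexp. simpl. rewrite exp_0, cos_0, sin_0.
    apply injective_projections; simpl; ring. }
  set (u t := (P (RtoC t * z) * Cexp (L 0 - L (RtoC t * z)))%C).
  assert (Hdisc : forall t, 0 <= t <= 1 -> in_disc (RtoC t * z)).
  { intros t Ht. unfold in_disc. rewrite Cmod_mult, Cmod_R, Rabs_pos_eq by lra. nra. }
  assert (HE : forall t, 0 <= t <= 1 -> is_Rderive (fun t => Cexp (L 0 - L (RtoC t * z))%C) t
    (Cexp (L 0 - L (RtoC t * z)) * (0 - z * H (RtoC t * z)))%C).
  { intros t Ht. apply (is_Rderive_Cexp (fun t => L 0 - L (RtoC t * z))%C).
    apply is_Rderive_minus; [apply is_Rderive_const|].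
    apply is_Rderive_comp; [apply HL, Hdisc, Ht | apply is_Rderive_linear]. }
  assert (Hu : u 1 = u 0).
  { apply Rderive_zero_constant.
    - intros t Ht.
      assert (Hd := is_Rderive_mult _ _ _ _ _
        (is_Rderive_comp _ _ _ _ _ (HP _ (Hdisc t ltac:(lra)) ltac:(apply Cmult_neq_0; [
          intros E; apply (f_equal fst) in E; simpl in E; lra | exact Hne]))
          (is_Rderive_linear z t)) (HE t ltac:(lra))).
      set (w := (RtoC t * z)%C) in Hd.
      assert (E : (z * (P w * H w) * Cexp (L 0 - L w) + P w * (Cexp (L 0 - L w) * (0 - z * H w)))%C = 0)
        by ring.
      rewrite <- E. exact Hd.
    - intros t Ht. apply Ccontinuous_mult.
      + apply (continuous_comp (U := R_UniformSpace) (V := C_UniformSpace) (W := C_UniformSpace)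
          (fun t => RtoC t * z)%C P); [|apply HPc, Hdisc, Ht].
        exact (is_Rderive_continuous _ _ _ (is_Rderive_linear z t)).
      + exact (is_Rderive_continuous _ _ _ (HE t Ht)). }
  unfold u in Hu.
  replace (RtoC 1 * z)%C with z in Hu by ring. replace (RtoC 0 * z)%C with (RtoC 0) in Hu by ring.
  replace (L 0 - L 0)%C with (- RtoC 0)%C in Hu by ring.
  assert (E0 : Cexp (- RtoC 0) = 1).
  { unfold Cexp. simpl. rewrite Ropp_0, exp_0, cos_0, sin_0.
    apply injective_projections; simpl; ring. }
  rewrite E0 in Hu. replace (P 0 * 1)%C with (P 0) in Hu by ring.
  rewrite <- Hu, <- Cmult_assoc.
  replace (L 0 - L z)%C with (- (L z - L 0))%C by ring.
  rewrite Cexp_opp_mult. ring.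
Qed.

Theorem theorem1p1
  (qc : nat -> R) (q : C -> C) (q1 : R)
  (qc_0 : qc O = 0)
  (qc_ge0 : forall j : nat, 0 <= qc j)
  (q_series : forall z : C, in_disc z ->
     is_pseries (K := C_AbsRing) (V := C_NormedModule)
       (fun j => RtoC (qc j)) z (q z))
  (q1_series : is_series qc q1)
  (q1_gt0 : 0 < q1) :
  exists Phi : C -> C,
    is_solution q q1 Phi /\
    (forall Psi : C -> C, is_solution q q1 Psi ->
       forall z : C, in_disc z -> Psi z = Phi z) /\
    (forall z : C, in_disc z ->
       exists I : C,
         (forall g : R -> C, path_in_disc g (RtoC 0) z ->
            is_line_integral (integrand q q1) g I) /\
         Phi z = (z * Cexp I)%C).
Proof.
  destruct (solution_coef qc q1 qc_0 qc_ge0 q1_series q1_gt0) as [a [Ha0 [Ha1 [Hab Ha]]]].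
  destruct (integrand_coef qc q1 qc_0 qc_ge0 q1_series q1_gt0) as [h [Hhb Hh]].
  set (ac n := RtoC (a n)). set (hc n := RtoC (h n)). set (cc n := RtoC (qc n)).
  assert (Hq : has_series cc 1 q) 
    by (intros z Hz; exact (proj1 (is_pseries_Cpseries cc z (q z)) (q_series z Hz))).
  (* [H] will be the integrand with its singularity filled, and [L] its primitive. *)
  set (Phi := CPS ac). set (H := CPS hc). set (L := CPS (prim_coef hc)).
  assert (HPhi : has_series ac 1 Phi).
  { apply has_series_CPS. intros s Hs. apply ex_series_linear_growth; [|exact Hs].
    intros n. unfold ac. destruct (Hab n). rewrite Cmod_R, Rabs_pos_eq; lra. }
  assert (HH : has_series hc 1 H).
  { apply has_series_CPS. intros s Hs. apply ex_series_linear_growth; [|exact Hs].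
    intros n. unfold hc. destruct (Hhb n). rewrite Cmod_R, Rabs_pos_eq; lra. }
  assert (HL : has_series (prim_coef hc) 1 L) by exact (has_series_prim _ _ _ HH).
  assert (Hac0 : ac O = 0) by (unfold ac; now rewrite Ha0).
  assert (Hcc0 : cc O = 0) by (unfold cc; now rewrite qc_0).
  assert (HP := has_series_div_z _ _ _ HPhi Hac0).
  set (P := fun z : C => if Ceq_dec z 0 then ac 1%nat else (Phi z / z)%C) in HP.
  set (M := CPS (prim_coef (fun n => ac (S n)))).
  assert (HM : has_series (prim_coef (fun n => ac (S n))) 1 M) by exact (has_series_prim _ _ _ HP).
  assert (HPhiP : forall z, in_disc z -> Phi z = (z * P z)%C).
  { intros z Hz. exact (has_series_unique _ 1 _ _ z HPhi (has_series_mul_z _ _ _ HP Hac0) Hz). }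
  assert (Hq_lt : forall z, in_disc z -> Cmod (q z) < q1).
  { intros z Hz. apply (Cmod_series_lt_total qc q1 z); auto. }
  assert (Hq_re : forall z, in_disc z -> Re (q z - RtoC q1) < 0).
  { intros z Hz. assert (H1 := Hq_lt z Hz). assert (H2 := Rabs_fst_le (q z)).
    assert (H3 := Rle_abs (fst (q z))). unfold Re. simpl. lra. }
  assert (Hq_ne : forall z, in_disc z -> q z <> RtoC q1).
  { intros z Hz E. assert (H1 := Hq_re z Hz). rewrite E in H1. unfold Re in H1. simpl in H1. lra. }
  assert (Hq1 : RtoC q1 <> 0) by (intros E; apply (f_equal fst) in E; simpl in E; lra).
  assert (Hac : forall n,
    (RtoC q1 * ac (S n) - conv cc ac (S n) = RtoC q1 * (ac (S n) / RtoC (INR (S n))))%C).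
  { intros n. unfold cc, ac. rewrite conv_RtoC.
    rewrite <- RtoC_div by (apply not_0_INR; lia). rewrite <- !RtoC_mult, <- RtoC_minus, Ha. reflexivity. }
  assert (Hhc : forall n, (RtoC q1 * hc n - conv cc hc n = (RtoC (INR n) + 2) * cc (S n))%C).
  { intros n. unfold cc, hc. rewrite conv_RtoC.
    rewrite <- RtoC_plus, <- !RtoC_mult, <- RtoC_minus, Hh. reflexivity. }
  assert (HMeq := proj1 (equation_coef_iff cc ac q1 1 q Phi Rlt_0_1 Hcc0 Hac0 Hq HPhi) Hac).
  fold M in HMeq.
  assert (Hint := fun z => integrand_equation cc hc q1 q H z Hq HH Hcc0 Hhc).
  exists Phi. split; [|split].
  - split; [|split; [|split]].
    + intros z Hz. exact (has_series_analytic_at _ _ _ _ HPhi Hz).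
    + intros z Hz.
      (* The left side of this replacement is the required value, the right side the one computed
         along the spiral; [HMeq] identifies them. *)
      replace (Phi z / RtoC q1)%C with (- M z / (q z - RtoC q1))%C.
      * exact (is_RInt_gen_decay ac 1 Phi z _ HPhi Hac0 Hz (Hq_re z Hz)).
      * assert (Hne : (q z - RtoC q1)%C <> 0).
        { intros E. assert (H1 := Hq_re z Hz). rewrite E in H1. simpl in H1. lra. }
        replace (M z) with (/ RtoC q1 * (RtoC q1 * M z))%C by (field; exact Hq1).
        rewrite <- HMeq by exact Hz. field. split; [exact Hq1 | exact Hne].
    + rewrite (has_series_at_0 _ _ _ Rlt_0_1 HPhi). exact Hac0.
    + replace (RtoC 1) with (ac 1%nat) by (unfold ac; now rewrite Ha1).
      exact (has_series_derive_0 _ _ _ Rlt_0_1 HPhi).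
  - intros Psi [HPan [HPint [HP0 HP1]]].
    destruct (analytic_at_has_series _ _ (HPan (RtoC 0) ltac:(unfold in_disc; rewrite Cmod_0; lra)))
      as [b [rho [Hrho Hb]]].
    (* The local expansion of [Psi] and the series of [q] are compared on their common disc. *)
    assert (Hr : 0 < Rmin rho 1) by (apply Rmin_pos; lra).
    assert (Hb' : has_series b (Rmin rho 1) Psi).
    { apply has_series_le with (rho := rho); [apply Rmin_l|].
      apply has_series_ext with (3 := Hb); [reflexivity|]. intros w _. f_equal. ring. }
    assert (Hb0 : b O = 0) by (rewrite <- HP0; symmetry; exact (has_series_at_0 _ _ _ Hr Hb')).
    assert (Hb1 : b 1%nat = 1).
    { rewrite <- (is_C_derive_unique _ _ _ HP1). symmetry. apply is_C_derive_unique.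
      exact (has_series_derive_0 _ _ _ Hr Hb'). }
    assert (Hbc : forall n,
      (RtoC q1 * b (S n) - conv cc b (S n) = RtoC q1 * (b (S n) / RtoC (INR (S n))))%C).
    { apply (equation_coef_iff cc b q1 (Rmin rho 1) q Psi Hr Hcc0 Hb0); [|exact Hb'|].
      - apply has_series_le with (2 := Hq). apply Rmin_r.
      - intros z Hz.
        assert (Hz1 : in_disc z) by exact (Rlt_le_trans _ _ _ Hz (Rmin_r _ _)).
        (* The assumed value and the spiral value of the same improper integral coincide, which is
           the cleared equation for [Psi]. *)
        assert (E := is_RInt_gen_C_unique _ _ _ (HPint z Hz1)
          (is_RInt_gen_decay b _ Psi z _ Hb' Hb0 Hz (Hq_re z Hz1))).
        assert (Hne : (q z - RtoC q1)%C <> 0).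
        { intros E'. assert (H1 := Hq_re z Hz1). rewrite E' in H1. simpl in H1. lra. }
        replace (Psi z) with (RtoC q1 * (Psi z / RtoC q1))%C by (field; exact Hq1).
        rewrite E. field. exact Hne. }
    assert (Hba : forall n, b n = ac n).
    { apply (solution_coef_unique cc q1); auto; [lra | congruence|].
      unfold ac. now rewrite Ha1. }
    apply (identity_theorem Psi Phi (Rmin rho 1) HPan).
    + intros z Hz. exact (has_series_analytic_at _ _ _ _ HPhi Hz).
    + exact Hr.
    + intros z Hz. apply (has_series_unique ac (Rmin rho 1)); [|  | exact Hz].
      * now apply has_series_ext with (3 := Hb').
      * apply has_series_le with (2 := HPhi). apply Rmin_r.
  - assert (HLd : forall w, in_disc w -> is_Cderive L w (H w)).
    { intros w Hw. apply (has_series_is_derive _ 1 _ _ _ HL); [|exact Hw].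
      apply has_series_ext with (3 := HH); [|reflexivity].
      intros n. exact (eq_sym (deriv_prim_coef hc n)). }
    assert (HHc : forall w, in_disc w -> continuous (T := C_UniformSpace) (U := C_UniformSpace) H w).
    { intros w Hw. exact (is_Cderive_continuous _ _ _ (has_series_C_derive_correct _ _ _ _ HH Hw)). }
    (* A difference of values of the primitive, hence one witness for all paths. *)
    intros z Hz. exists (L z - L 0)%C. split.
    + intros g Hg. apply (line_integral_primitive L H); auto.
      apply integrand_eq; auto. apply HHc. unfold in_disc. rewrite Cmod_0. lra.
    + rewrite HPhiP by exact Hz. f_equal.
      rewrite (exp_primitive P L H z Hz HLd).
      (* The constant factor is [P 0 = ac 1 = 1]. *)
      * rewrite (has_series_at_0 _ _ _ Rlt_0_1 HP). unfold ac. rewrite Ha1. ring.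
      * intros w Hw Hw0.
        assert (HPd := has_series_C_derive_correct _ _ _ _ HP Hw).
        rewrite <- (log_derivative q M P H q1 w (C_derive P w)); auto.
        -- exact (has_series_C_derive_correct _ _ _ _ Hq Hw).
        -- apply (has_series_is_derive _ 1 _ _ _ HM); [|exact Hw].
           apply has_series_ext with (3 := HP); [|reflexivity].
           intros n. exact (eq_sym (deriv_prim_coef (fun n => ac (S n)) n)).
        -- intros v Hv. rewrite <- HPhiP by exact Hv. now apply HMeq.
      * intros w Hw. exact (is_Cderive_continuous _ _ _ (has_series_C_derive_correct _ _ _ _ HP Hw)).
Qed.
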